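(* Let $K$ be a number field and $S$ a finite set of primes of $K$. Then the number of Galois extensions $L/K$ that are unramified outside $S$ and whose Galois group is isomorphic to $C_2$, $C_3$ or $S_3$ is finite.
   Context: Primes are non-archimedean (nonzero prime ideals of the ring of integers). Extensions $L/K$ are taken inside a fixed algebraic closure of $K$ (equivalently, counted up to $K$-isomorphism). ''Unramified outside $S$'' means unramified at every non-archimedean prime of $K$ not in $S$. $C_n$ is the cyclic group of order $n$, $S_3$ the symmetric group on three letters. *)

(* Defs.v *)
From HB Require Import structures.
From mathcomp Require Import all_boot all_order all_algebra.
From mathcomp Require Import all_fingroup all_solvable all_field.
From mathcomp Require Import mathcomp_extra boolp classical_sets functions.
From mathcomp Require Import cardinality.

Set Implicit Arguments.
Unset Strict Implicit.
Unset Printing Implicit Defensive.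

Import GRing.Theory.

Definition gal_C2_C3_or_S3 (K : fieldType) (L : splittingFieldType K) : Prop :=
  [\/ 'Gal({:L} / 1) \isog Zp 2,
      'Gal({:L} / 1) \isog Zp 3
    | 'Gal({:L} / 1) \isog [set: 'S_3]]%g.

Local Open Scope classical_set_scope.
Local Open Scope ring_scope.

(* The ring of integers of F, its ideals and its primes are represented as
   subsets of F; an ideal of O_F is in particular contained in O_F. *)
Definition ring_of_integers (F : fieldType) : set F :=
  [set x | integralOver (fun n : int => n%:~R : F) x].
Arguments ring_of_integers : clear implicits.

Definition is_ideal (F : fieldType) (I : set F) : Prop :=
  [/\ I `<=` ring_of_integers F,
      I 0,
      forall x y, I x -> I y -> I (x + y)
    & forall a x, ring_of_integers F a -> I x -> I (a * x)].

Definition is_prime (F : fieldType) (P : set F) : Prop :=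
  [/\ is_ideal P,
      P <> [set 0],
      ~ P 1
    & forall a b, ring_of_integers F a -> ring_of_integers F b ->
        P (a * b) -> P a \/ P b].

Definition ideal_span (F : fieldType) (A : set F) : set F :=
  smallest (@is_ideal F) A.

Definition ideal_mul (F : fieldType) (I J : set F) : set F :=
  ideal_span [set x * y | x in I & y in J].

Definition ideal_exp (F : fieldType) (I : set F) (n : nat) : set F :=
  iter n (ideal_mul I) (ring_of_integers F).

Definition ideal_extension (K : fieldType) (L : fieldExtType K) (p : set K) :
    set L :=
  ideal_span (in_alg L @` p).
Arguments ideal_extension [K] L p _.

Definition lies_over (K : fieldType) (L : fieldExtType K) (P : set L)
    (p : set K) : Prop :=
  in_alg L @^-1` P = p.

(* In a Dedekind domain P ^ e divides p O_L iff it contains it, so e is the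
   exponent of P in the factorization of p O_L. *)
Definition has_ramification_index (K : fieldType) (L : fieldExtType K)
    (p : set K) (P : set L) (e : nat) : Prop :=
  ideal_extension L p `<=` ideal_exp P e /\
  ~ (ideal_extension L p `<=` ideal_exp P e.+1).

(* Residue fields of number fields are finite, so residue extensions are
   automatically separable. *)
Definition unramified_at (K : fieldType) (L : fieldExtType K) (p : set K) :
    Prop :=
  forall P : set L, is_prime P -> lies_over P p ->
    has_ramification_index p P 1.

Definition unramified_outside (K : fieldType) (L : fieldExtType K)
    (S : set (set K)) : Prop :=
  forall p : set K, is_prime p -> ~ S p -> unramified_at L p.

(* Main.v *)
From HB Require Import structures.
Require Import Defs.
From mathcomp Require Import all_boot all_order all_algebra.
From mathcomp Require Import all_fingroup all_solvable all_field.
From mathcomp Require Import mathcomp_extra boolp classical_sets functions.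
From mathcomp Require Import cardinality.
From mathcomp Require Import ring lra zify.

(** The proof is by Kummer theory. The arithmetic input is [selmer_finite]: in
    a number field F, the nonzero elements a whose valuation is divisible by n
    at every prime outside a finite set T fall into finitely many classes
    modulo n-th powers.

    For such an a, which may be taken integral, consider the b in O for which
    y = b^n / a^(n-1) is integral. As the valuations of a are divisible by n
    outside T, these b contain an ideal of index at most a constant times
    |N a|^((n-1)/n) in O. This is exactly the size that permits to find, by
    the pigeonhole principle ([minkowski]), such a b <> 0 whose conjugates are
    all bounded by a constant times those of a to the power (n-1)/n. The
    conjugates of y are then bounded independently of a, so that y runs
    through a finite set ([bounded_finite]); and y = a (b/a)^n is in the class
    of a.

    The indices of ideals are computed with the valuations at the primes of O.
    These are built from one element gamma of the inverse of a prime ideal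
    P, outside O ([gamma_exists]): every nonzero element of F is a power of
    gamma times a quotient of elements of O outside P.

    Let now L/K be as in the theorem. If its group has order 2, then L = K(de)
    with de^2 = a in K. At an unramified prime, the valuation of a is twice
    that of de, hence even. So de can be scaled by an element of K so that its
    square lies in a finite set.

    If the group has order 3 or 6, let s be an element of order 3. Its fixed
    field is K(de) with de^2 in K, and as above de is among finitely many
    elements. Put M = K(de, zeta) with zeta a primitive cube root of unity. A
    Lagrange resolvent al of L over the fixed field of s satisfies al^3 in M.
    The ramification indices of L(zeta)/K are at most 2 outside S, hence prime
    to 3, so that the valuations of al^3 in M are divisible by 3. Again al can
    be scaled into a finite set. Finally L is contained in K(de, zeta, al), and
    such a field has only finitely many subfields ([finite_subfields]). *)

Set Implicit Arguments.
Unset Strict Implicit.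
Unset Printing Implicit Defensive.

Import Order.TTheory GRing.Theory Num.Theory.

Local Open Scope classical_set_scope.
Local Open Scope ring_scope.

Local Notation pQto F := (map_poly (in_alg F)).

(** * Rings of integers of number fields *)

Section NumberFieldBasics.
Variable F : fieldExtType rat.
Local Notation O := (ring_of_integers F).

Lemma intrF_eq0 (n : int) : (n%:~R == 0 :> F) = (n == 0).
Proof. by rewrite -(rmorph_int (in_alg F)) fmorph_eq0 intr_eq0. Qed.
Lemma intrF_inj : injective (fun n : int => n%:~R : F).
Proof. by move=> m n /eqP; rewrite -subr_eq0 -rmorphB intrF_eq0 subr_eq0 => /eqP. Qed.

Lemma pcharF0 : [pchar F] =i pred0.
Proof. by apply/pcharf0P => n; rewrite pmulrn intrF_eq0. Qed.

Lemma Oint (n : int) : O n%:~R.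
Proof. exact: integral_id. Qed.
Lemma O0 : O 0. Proof. exact: (Oint 0). Qed.
Lemma O1 : O 1. Proof. exact: (Oint 1). Qed.
Lemma OD x y : O x -> O y -> O (x + y).
Proof. exact: integral_add. Qed.
Lemma OM x y : O x -> O y -> O (x * y).
Proof. exact: integral_mul. Qed.
Lemma ON x : O x -> O (- x).
Proof. exact: integral_opp. Qed.
Lemma OB x y : O x -> O y -> O (x - y).
Proof. by move=> Ox Oy; apply/OD/ON. Qed.
Lemma OX x n : O x -> O (x ^+ n).
Proof. by move=> Ox; elim: n => [|n IH]; rewrite ?expr0 ?exprS; [apply: O1|apply: OM]. Qed.
Lemma Osum (I : Type) (r : seq I) (P : pred I) (G : I -> F) :
  (forall i, P i -> O (G i)) -> O (\sum_(i <- r | P i) G i).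
Proof. by move=> H; elim/big_rec: _ => [|i x Pi Ox]; [apply: O0|apply: OD; first exact: H]. Qed.

Lemma Oroot p x : p \is monic -> root p x -> (forall i, O p`_i) -> O x.
Proof.
move=> mp rp Op; apply: (integral_root_monic mp rp).
by apply/integral_poly.
Qed.

End NumberFieldBasics.

Section Embed.
Variables (F : fieldExtType rat) (s : {rmorphism F -> algC}).
(** An embedding into algC gives access to the fact that a rational
    algebraic integer is an integer. *)
Lemma O_Aint x : ring_of_integers F x <-> s x \in Aint.
Proof.
split=> [[p mp rp]|].
  have mp' : map_poly intr p \is @monic algC by rewrite monic_map.
  have ip : map_poly intr p \is a @polyOver algC Num.int.
    by apply/polyOverP => i; rewrite coef_map /= rpred_int.
  apply: root_monic_Aint mp' ip.
  have: root (map_poly s (map_poly (fun n : int => n%:~R) p)) (s x) by rewrite fmorph_root.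
  by rewrite -map_poly_comp; congr (root _ _); apply: eq_map_poly => n /=; rewrite rmorph_int.
move=> sx; have /floorpP [q Dq] := sx.
have mq : q \is monic.
  have := minCpoly_monic (s x); rewrite Dq.
  by rewrite !monicE lead_coef_map_inj //= ?(eqr_int _ _ 1) //; exact: intr_inj.
exists q => //.
rewrite -(fmorph_root s) -map_poly_comp.
have := root_minCpoly (s x); rewrite Dq; congr (root _ _).
by apply: eq_map_poly => n /=; rewrite rmorph_int.
Qed.
End Embed.

Section Prim.
Variable F : fieldExtType rat.
Local Notation O := (ring_of_integers F).

Lemma rat_minPoly (x : F) :
  exists2 p : {poly rat}, pQto F p = minPoly 1%AS x &
    forall q, root (pQto F q) x -> p %| q.
Proof.
have /polyOver1P [p Ep] := minPolyOver 1%AS x.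
exists p => [|q rq]; first by rewrite Ep.
rewrite -(dvdp_map (in_alg F)) -Ep; apply: minPoly_dvdp => //.
by apply/polyOver1P; exists q.
Qed.

Lemma algebraic_rat (x : F) : exists2 p : {poly int}, p != 0 & root (map_poly intr p) x.
Proof.
have [q Eq _] := rat_minPoly x; have [r [a a0 Er]] := rat_poly_scale q.
exists r.
  apply/eqP => r0; move: Eq; rewrite Er r0 rmorph0 scaler0 rmorph0 => /esym/eqP.
  by apply/negP; rewrite monic_neq0 ?monic_minPoly.
have: root (pQto F (a%:~R *: q)) x.
  by rewrite -mul_polyC rmorphM /= Eq rootM root_minPoly orbT.
rewrite Er scalerA divff ?intr_eq0 // scale1r -map_poly_comp; congr (root _ _).
by apply: eq_map_poly => n /=; rewrite scaler_int.
Qed.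

(** If p has degree d, leading coefficient c and root x, then c x is a root
    of the monic polynomial c^(d-1) p(X/c). *)
Lemma integral_multiple (x : F) : exists2 m : int, m != 0 & O (m%:~R * x).
Proof.
have [p p0 rp] := algebraic_rat x.
have c0 : lead_coef p != 0 by rewrite lead_coef_eq0.
exists (lead_coef p) => //; set c := lead_coef p.
have sp : (1 < size p)%N.
  have Ep : size (map_poly intr p : {poly F}) = size p.
    by rewrite size_map_inj_poly //; exact: intrF_inj.
  by rewrite -Ep (root_size_gt1 _ rp) // -size_poly_eq0 Ep size_poly_eq0.
pose d := (size p).-1.
have Ed : size p = d.+1 by rewrite /d prednK // ltnW.
pose q := \poly_(i < d.+1) (if i == d then 1 else (p`_i * c ^+ (d.-1 - i))).
have q_d : q`_d = 1 by rewrite coef_poly ltnSn eqxx.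
have sq : size q = d.+1 by apply: size_poly_eq; rewrite eqxx oner_eq0.
exists q; first by rewrite monicE lead_coefE sq /= q_d.
rewrite /root.
have -> : (map_poly (fun n : int => n%:~R) q).[c%:~R * x] =
   \sum_(i < d.+1) (q`_i)%:~R * (c%:~R * x) ^+ i :> F.
  rewrite (@horner_coef_wide _ d.+1) ?size_map_inj_poly ?sq //.
    by apply: eq_bigr => i _; rewrite coef_map.
  exact: intrF_inj.
have d0 : (0 < d)%N by rewrite -ltnS -Ed.
rewrite (_ : \sum_(i < _) _ = c%:~R ^+ d.-1 * (map_poly intr p).[x]).
  by rewrite (rootP rp) mulr0.
rewrite (@horner_coef_wide _ d.+1) ?size_map_inj_poly ?Ed //; last exact: intrF_inj.
rewrite mulr_sumr; apply: eq_bigr => i _; rewrite coef_map coef_poly ltn_ord /=.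
have [->|nid] := eqVneq (i : nat) d.
  by rewrite mul1r exprMn mulrA {2}/c lead_coefE Ed /= -exprSr prednK.
have lid : (i <= d.-1)%N by have := ltn_ord i; lia.
have -> : c%:~R ^+ d.-1 = c%:~R ^+ (d.-1 - i) * c%:~R ^+ i :> F by rewrite -exprD subnK.
by rewrite rmorphM rmorphXn /= exprMn; ring.
Qed.

Lemma integral_primitive : exists2 th : F, O th &
  forall x, exists p : {poly rat}, x = (pQto F p).[th].
Proof.
have sep : separable 1%AS {:F}%AS.
  by apply/separableP => y _; apply: pcharf0_separable; apply: pcharF0.
have E := eq_adjoin_separable_generator sep (sub1v _).
set z := separable_generator 1 _ in E.
have [m m0 Om] := integral_multiple z.
exists (m%:~R * z) => // x.
have /Fadjoin_polyP [q /polyOver1P [q' Eq] Ex] : x \in <<1; z>>%VS by rewrite -E memvf.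
exists (\poly_(i < size q') (q'`_i / m%:~R ^+ i)).
rewrite Ex Eq horner_coef size_map_poly (@horner_coef_wide _ (size q')); last first.
  by rewrite size_map_poly size_poly.
apply: eq_bigr => i _; rewrite !coef_map coef_poly ltn_ord /= exprMn -!in_algE.
have m0' : m%:~R != 0 :> F by rewrite intrF_eq0.
by rewrite fmorph_div rmorphXn rmorph_int mulrA divfK ?expf_neq0.
Qed.

End Prim.

(** * Complex embeddings *)

(** An element q(th) is sent to q(z); by minimality of p, the value does not
    depend on the choice of q. *)
Lemma rat_root_morphism (F : fieldExtType rat) (th : F) (p : {poly rat}) (z : algC) :
  (forall x, exists q : {poly rat}, x = (pQto F q).[th]) ->
  (forall q, root (pQto F q) th -> p %| q) ->
  root (map_poly ratr p) z ->
  exists s : {rmorphism F -> algC}, s th = z.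
Proof.
move=> gen min_p pz0.
have [h Eh] := choice gen.
have ev q1 q2 : (pQto F q1).[th] = (pQto F q2).[th] ->
   (map_poly ratr q1).[z] = (map_poly ratr q2).[z] :> algC.
  move=> E; apply/eqP; rewrite -subr_eq0 -hornerN -hornerD -!rmorphN -!rmorphD /=.
  have /dvdpP [r ->] : p %| q1 - q2.
    by apply: min_p; rewrite /root !rmorphB hornerD hornerN E subrr.
  by rewrite rmorphM hornerM (rootP pz0) mulr0.
pose s x : algC := (map_poly ratr (h x)).[z].
have s_add : zmod_morphism s.
  move=> x y; rewrite /s -hornerN -hornerD -!rmorphN -!rmorphD /=.
  by apply: ev; rewrite -Eh rmorphB /= hornerD hornerN -!Eh.
have s_mul : monoid_morphism s.
  split=> [|x y]; rewrite /s.
    have -> : 1 = (map_poly ratr (1 : {poly rat})).[z] :> algC.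
      by rewrite rmorph1 hornerC.
    by apply: ev; rewrite -Eh rmorph1 hornerC.
  by rewrite -hornerM -rmorphM /=; apply: ev; rewrite -Eh rmorphM /= hornerM -!Eh.
pose s1 := GRing.isZmodMorphism.Build _ _ s s_add.
pose s2 := GRing.isMonoidMorphism.Build _ _ s s_mul.
pose s3 : {rmorphism _ -> _} := HB.pack s s1 s2.
exists s3; rewrite /= /s.
transitivity ((map_poly ratr ('X : {poly rat})).[z] : algC); last first.
  by rewrite map_polyX hornerX.
by apply: ev; rewrite -Eh map_polyX hornerX.
Qed.

(** The complex embeddings of F, described on the powers of an integral
    generator th. The embeddings and the powers of th have the same index
    set, so that their values form a square matrix. The permutation cj
    describes complex conjugation on the embeddings. *)
Record frame (F : fieldExtType rat) := Frame {
  dg : nat;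
  th : F;
  emb : 'I_dg -> {rmorphism F -> algC};
  cj : 'I_dg -> 'I_dg;
  th_int : ring_of_integers F th;
  th_gen : forall x, exists q : 'I_dg -> rat, x = \sum_i q i *: th ^+ i;
  emb_inj : injective (fun i => emb i th);
  cjK : involutive cj;
  emb_cj : forall i x, emb (cj i) x = (emb i x)^*
}.

Lemma frame_exists (F : fieldExtType rat) : exists fr : frame F, True.
Proof.
have [th Oth gen] := integral_primitive F.
have [p Ep min_p] := rat_minPoly th.
have mp : p \is monic by rewrite -(map_monic (in_alg F)) Ep monic_minPoly.
have sp : separable_poly (map_poly ratr p : {poly algC}).
  rewrite separable_map -(separable_map (in_alg F)) Ep.
  exact: (pcharf0_separable 1%AS (@pcharF0 F)).
have [r Dr] := closed_field_poly_normal (map_poly ratr p : {poly algC}).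
rewrite lead_coef_map (monicP mp) rmorph1 scale1r in Dr.
have ur : uniq r by rewrite -separable_prod_XsubC -Dr.
have inr z : root (map_poly ratr p) z = (z \in r) by rewrite Dr root_prod_XsubC.
have szp : size p = (size r).+1.
  by rewrite -(size_map_poly (ratr : rat -> algC)) Dr size_prod_XsubC.
have root_i (i : 'I_(size r)) : exists s : {rmorphism F -> algC}, s th = r`_i.
  by apply: (rat_root_morphism gen min_p); rewrite inr mem_nth.
have [s Es] := choice root_i.
have cj_i (i : 'I_(size r)) : exists j : 'I_(size r), r`_j = (r`_i)^*.
  have : (r`_i)^* \in r.
    rewrite -inr; have : root (map_poly ratr p) r`_i by rewrite inr mem_nth.
    rewrite -(fmorph_root (Num.conj : {rmorphism algC -> algC})) -map_poly_comp.
    by congr (root _ _); apply: eq_map_poly => a /=; rewrite fmorph_rat.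
  by move=> /(nthP 0) [j jr Ej]; exists (Ordinal jr).
have [c Ec] := choice cj_i.
have inj_s : injective (fun i => s i th).
  by move=> i j /eqP; rewrite !Es nth_uniq // => /eqP /val_inj.
have s_gen i q : s i (pQto F q).[th] = (map_poly ratr q).[r`_i].
  rewrite -horner_map Es -map_poly_comp; congr _.[_].
  by apply: eq_map_poly => a /=; rewrite rmorphZ_num rmorph1 mulr1.
have gen' x : exists q : 'I_(size r) -> rat, x = \sum_i q i *: th ^+ i.
  have [q ->] := gen x.
  exists (fun i => (q %% p)`_i).
  rewrite {1}(divp_eq q p) rmorphD rmorphM hornerD hornerM.
  have -> : (pQto F p).[th] = 0 by rewrite Ep minPolyxx.
  rewrite mulr0 add0r (@horner_coef_wide _ (size r)).
    by apply: eq_bigr => i _; rewrite coef_map /= mulr_algl.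
  by rewrite size_map_poly -ltnS -szp ltn_modp monic_neq0.
have cK : involutive c.
  by move=> i; apply: inj_s; rewrite /= !Es !Ec conjCK.
have s_c i x : s (c i) x = (s i x)^*.
  have [q ->] := gen x; rewrite !s_gen Ec.
  rewrite -[RHS](horner_map (Num.conj : {rmorphism algC -> algC})) -map_poly_comp /=.
  by congr _.[_]; apply: eq_map_poly => a /=; rewrite fmorph_rat.
by exists (Frame Oth gen' inj_s cK s_c).
Qed.

(** * The lattice of algebraic integers *)

(** After division by a power of X, the constant term of p is nonzero, and it
    is a multiple of x since p(x) = 0. *)
Lemma int_multiple_of_root (R : fieldType) (p : {poly int}) (x : R) :
  p != 0 -> x != 0 -> root (map_poly intr p) x ->
  exists2 m : int, m != 0 & exists r : {poly int}, x * (map_poly intr r).[x] = m%:~R.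
Proof.
move=> p0 x0; elim/poly_ind: p p0 => [|p c IH]; first by rewrite eqxx.
rewrite /root rmorphD rmorphM /= map_polyX map_polyC hornerD hornerM hornerX hornerC.
have [-> |c0 _] := eqVneq c 0.
  rewrite /= mulr0z !addr0 => pX; rewrite mulf_eq0 (negPf x0) orbF.
  by apply: IH; apply: contraNneq pX => ->; rewrite mul0r.
move=> /eqP E; exists (- c); first by rewrite oppr_eq0.
by exists p; rewrite mulrC rmorphN /=; apply/eqP; rewrite -addr_eq0 E.
Qed.

Lemma Aint_horner (r : {poly int}) x : x \in Aint -> (map_poly intr r).[x] \in Aint.
Proof.
move=> Ax; rewrite horner_coef rpred_sum // => i _.
by rewrite rpredM ?rpredX // coef_map /= Aint_int.
Qed.

Lemma Aint_multiple x : x \in Aint -> x != 0 ->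
  exists2 m : int, m != 0 & exists2 y, y \in Aint & x * y = m%:~R.
Proof.
move=> Ax x0; have /floorpP [q Dq] := Ax.
have q0 : q != 0.
  by apply/eqP => q0; have := minCpoly_eq0 x; rewrite Dq q0 rmorph0 eqxx.
have [|m m0 [r Er]] := int_multiple_of_root q0 x0; first by rewrite -Dq root_minCpoly.
by exists m => //; exists (map_poly intr r).[x] => //; apply: Aint_horner.
Qed.

Lemma O_dvd_int (F : fieldExtType rat) (x : F) : ring_of_integers F x -> x != 0 ->
  exists2 m : int, m != 0 & exists2 y, ring_of_integers F y & x * y = m%:~R.
Proof.
move=> [p mp rp] x0; have [|m m0 [r Er]] := int_multiple_of_root (monic_neq0 mp) x0.
  exact: rp.
exists m => //; exists (map_poly intr r).[x] => //.
rewrite horner_coef; apply: Osum => i _; rewrite coef_map; apply: OM; first exact: Oint.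
by apply: OX; exists p.
Qed.

Lemma Aint_det n (A : 'M[algC]_n) : (forall i j, A i j \in Aint) -> \det A \in Aint.
Proof. by move=> AA; apply: rpred_sum => s _; rewrite rpredMsign rpred_prod. Qed.

Section Lattice.
Variables (F : fieldExtType rat) (fr : frame F).
Local Notation O := (ring_of_integers F).
Local Notation d := (dg fr).
Local Notation th := (th fr).
Local Notation emb := (emb (f := fr)).

Definition embmx : 'M[algC]_d := \matrix_(i, j) emb i th ^+ j.
Definition int_comb (u : 'rV[int]_d) : F := \sum_j (u 0 j)%:~R * th ^+ j.

Lemma embmx_unit : embmx \in unitmx.
Proof.
rewrite -unitmx_tr (_ : embmx^T = Vandermonde d (\row_i emb i th)); last first.
  by apply/matrixP => i j; rewrite !mxE.
rewrite unitmxE det_Vandermonde unitfE; apply/prodf_neq0 => i _.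
apply/prodf_neq0 => j ij; rewrite !mxE subr_eq0; apply: contraTneq ij => /emb_inj ->.
by rewrite ltnn.
Qed.

Lemma int_combD u v : int_comb (u + v) = int_comb u + int_comb v.
Proof. by rewrite -big_split; apply: eq_bigr => j _; rewrite !mxE rmorphD mulrDl. Qed.
Lemma int_combN u : int_comb (- u) = - int_comb u.
Proof. by rewrite -sumrN; apply: eq_bigr => j _; rewrite !mxE rmorphN mulNr. Qed.
Lemma int_combB u v : int_comb (u - v) = int_comb u - int_comb v.
Proof. by rewrite int_combD int_combN. Qed.
Lemma O_int_comb u : O (int_comb u).
Proof. by apply: Osum => j _; apply: OM; [exact: Oint | apply: OX; exact: th_int]. Qed.

Lemma emb_int_comb i u : emb i (int_comb u) = (embmx *m (map_mx intr u)^T) i 0.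
Proof.
rewrite !mxE rmorph_sum; apply: eq_bigr => j _.
by rewrite rmorphM rmorph_int rmorphXn !mxE mulrC.
Qed.

Lemma int_comb_inj : injective int_comb.
Proof.
move=> u v E; apply/rowP => j.
have V0 : embmx *m (map_mx intr (u - v))^T = 0.
  apply/matrixP => i k; rewrite (ord1 k) -emb_int_comb int_combB E subrr rmorph0 mxE //.
have := mulKmx embmx_unit (map_mx intr (u - v))^T; rewrite V0 mulmx0.
move=> /matrixP/(_ j 0); rewrite !mxE => /esym/eqP.
by rewrite intr_eq0 subr_eq0 => /eqP.
Qed.

Lemma emb_int i x : O x -> emb i x \in Aint.
Proof. exact: (O_Aint (emb i) x).1. Qed.

(** By Cramer's rule, the determinant of the embeddings makes the coordinates
    of all algebraic integers integral over the integers. So does an integer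
    multiple of this determinant, and the coordinates are then rational. *)
Lemma bounded_denominator : exists2 D : int, D != 0 &
  forall x, O x -> exists u, D%:~R * x = int_comb u.
Proof.
have vA : \det embmx \in Aint.
  by apply: Aint_det => i j; rewrite mxE rpredX // emb_int //; exact: th_int.
have v0 : \det embmx != 0 by have := embmx_unit; rewrite unitmxE unitfE.
have [m m0 [y Ay Ey]] := Aint_multiple vA v0.
exists m => // x Ox; have [q Eq] := th_gen fr x.
have qint j : exists n : int, m%:~R * q j = n%:~R.
  suff /intrP [n En] : ratr (m%:~R * q j) \is a @Num.int algC.
    by exists n; apply: (fmorph_inj (ratr : {rmorphism rat -> algC})); rewrite /= En rmorph_int.
  apply: Cint_rat_Aint; first by apply/CratP; exists (m%:~R * q j).
  pose Q : 'cV[algC]_d := \col_j ratr (q j).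
  have EQ : embmx *m Q = \col_i emb i x.
    apply/matrixP => i k; rewrite (ord1 k) !mxE Eq rmorph_sum /=.
    by apply: eq_bigr => l _; rewrite !mxE rmorphZ_num rmorphXn /= mulrC.
  have := congr1 (mulmx (\adj embmx)) EQ; rewrite mulmxA mul_adj_mx mul_scalar_mx.
  move=> /matrixP/(_ j 0); rewrite !mxE => E.
  rewrite rmorphM rmorph_int /= -Ey mulrAC [_ * y]mulrC; apply: rpredM => //.
  rewrite E; apply: rpred_sum => i _; rewrite !mxE; apply: rpredM; last exact: emb_int.
  rewrite /cofactor rpredMsign; apply: Aint_det => k l.
  by rewrite !mxE rpredX // emb_int //; exact: th_int.
have [n En] := choice qint.
exists (\row_j n j); rewrite Eq mulr_sumr; apply: eq_bigr => j _.
rewrite mxE -mulr_algl mulrA; congr (_ * _).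
by rewrite -(rmorph_int (in_alg F)) -[X in _ * X]in_algE -rmorphM En rmorph_int.
Qed.
End Lattice.

(** * Counting lattice points *)

Lemma absz_unit (n : int) : n \is a GRing.unit -> `|n|%N = 1%N.
Proof. by rewrite qualifE /= => /orP [] /eqP ->. Qed.

Lemma box_pigeonhole (T : finType) n (b : 'I_n -> nat) (f : T -> 'I_n -> nat) :
  (forall t i, f t i < b i)%N -> (forall t u, (forall i, f t i = f u i) -> t = u) ->
  (#|T| <= \prod_i b i)%N.
Proof.
move=> f_lt f_inj; pose M := (\max_i b i).+1.
have leM i : (b i < M)%N by rewrite ltnS; exact: (leq_bigmax i).
pose g t : {ffun 'I_n -> 'I_M} := [ffun i => inord (f t i)].
have gE t i : g t i = f t i :> nat.
  by rewrite ffunE inordK // (ltn_trans (f_lt t i)).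
have g_inj : injective g.
  by move=> t u E; apply: f_inj => i; rewrite -!gE E.
rewrite -(fintype.card_image g_inj).
apply: (@leq_trans #|family (fun i : 'I_n => [pred x : 'I_M | (x < b i)%N])|).
  apply: fintype.subset_leq_card; apply/fintype.subsetP => _ /fintype.imageP [t _ ->].
  by apply/familyP => i; rewrite inE gE.
rewrite card_family foldrE big_image /=; apply: leq_prod => i _.
rewrite cardE -(size_map val) -[leqRHS](size_iota 0); apply: uniq_leq_size.
  by rewrite (map_inj_uniq val_inj) enum_uniq.
by move=> y /mapP [x]; rewrite mem_enum => lx ->; rewrite mem_iota.
Qed.

(** By the Smith normal form, A is diagonal up to changes of basis on both
    sides; rows are then separated by the residues of their coordinates modulo
    the diagonal entries, whose product is the determinant. *)
Lemma rows_mod_matrix d (A : 'M[int]_d) m (f : 'I_m -> 'rV[int]_d) :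
  \det A != 0 -> (forall k l, k != l -> forall w, f k - f l <> w *m A) ->
  (m <= `|\det A|)%N.
Proof.
move=> A0 fN; have [L uL [R uR [e _ EA]]] := int_Smith_normal_form A.
pose De := diag_mx (\row_(i < d) e`_i).
have EDe : A = L *m De *m R.
  by rewrite EA; congr (_ *m _ *m _); apply/matrixP => i j; rewrite !mxE.
have Edet : `|\det A|%N = (\prod_(i < d) `|(e`_i)%R|)%N.
  rewrite EDe !det_mulmx !abszM (@absz_unit (\det L)) -?unitmxE //.
  rewrite (@absz_unit (\det R)) -?unitmxE // mul1n muln1.
  rewrite det_diag; elim/big_ind2: _ => // [x1 x2 y1 y2 <- <-|i _].
    by rewrite abszM.
  by rewrite mxE.
have e0 i : (i < d)%N -> (e`_i)%R != 0.
  move=> ltid; move: A0; rewrite EDe !det_mulmx det_diag !mulf_eq0 !negb_or.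
  by move=> /andP [/andP [_ /prodf_neq0 /(_ (Ordinal ltid) isT)]]; rewrite mxE.
pose g k := f k *m invmx R.
pose w k (i : 'I_d) : nat := `|modz (g k 0%R i) (e`_i)%R|%N.
have w_lt k i : (w k i < `|(e`_i)%R|)%N.
  have := ltz_mod (g k 0 i) (e0 i (ltn_ord i)).
  have := modz_ge0 (g k 0 i) (e0 i (ltn_ord i)).
  by rewrite /w; case: (modz _ _) => // n _; rewrite -ltz_nat.
rewrite Edet -(card_ord m).
apply: (@box_pigeonhole _ _ _ w) => // k l Ekl.
apply/eqP; apply: contraT => /fN fkl.
have md i : exists q : int, g k 0 i - g l 0 i = q * (e`_i)%R.
  have := modz_ge0 (g k 0 i) (e0 i (ltn_ord i)).
  have := modz_ge0 (g l 0 i) (e0 i (ltn_ord i)).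
  move=> p1 p2; have /(congr1 Posz) := Ekl i; rewrite /w !gez0_abs // => E.
  exists (divz (g k 0 i) (e`_i)%R - divz (g l 0 i) (e`_i)%R).
  rewrite {1}(divz_eq (g k 0 i) (e`_i)%R) {1}(divz_eq (g l 0 i) (e`_i)%R) E; ring.
have [q Eq] := choice md.
case: (fkl ((\row_i q i) *m invmx L)).
rewrite EDe !mulmxA mulmxKV //.
rewrite -[LHS](mulmxKV uR) mulmxBl -/(g k) -/(g l); congr (_ *m _).
apply/rowP => i; transitivity (q i * (e`_i)%R); last by rewrite mul_mx_diag !mxE.
by rewrite -Eq !mxE.
Qed.

Section Lattice2.
Variables (F : fieldExtType rat) (fr : frame F).
Local Notation O := (ring_of_integers F).
Local Notation d := (dg fr).
Local Notation th := (th fr).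
Local Notation emb := (emb (f := fr)).
Local Notation int_comb := (@int_comb F fr).
Local Notation embmx := (embmx fr).

Definition emb_norm (x : F) : algC := \prod_i emb i x.

Lemma emb_normM x y : emb_norm (x * y) = emb_norm x * emb_norm y.
Proof. by rewrite /emb_norm -big_split; apply: eq_bigr => i _; rewrite rmorphM. Qed.

Lemma emb_norm_eq0 x : (emb_norm x == 0) = (x == 0).
Proof.
apply/idP/idP => [|/eqP ->]; last first.
  have [i|d0] := pickP (pred_of_simpl (@predT 'I_d)).
    by move=> _; rewrite /emb_norm (bigD1 i) //= rmorph0 mul0r.
  have [q /eqP] := th_gen fr 1; rewrite big1 ?oner_eq0 // => i.
  by have := d0 i.
by move/prodf_eq0 => [i _]; rewrite fmorph_eq0.
Qed.

(** If D sends O into the lattice of integral combinations of the powers of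
    th, then multiplication by D a acts on this lattice with determinant the
    norm of D a, and elements of O that differ modulo a O remain different
    modulo D a in the lattice. *)
Lemma index_principal : exists C : nat, forall a, O a -> a != 0 ->
  forall m (f : 'I_m -> F), (forall k, O (f k)) ->
  (forall k l, k != l -> forall y, O y -> f k - f l <> a * y) ->
  m%:R <= C%:R * `|emb_norm a|.
Proof.
have [D D0 HD] := bounded_denominator fr.
exists (`|D| ^ d)%N => a Oa a0 m f Of fN.
have D0F : D%:~R != 0 :> F by rewrite intrF_eq0.
have Oath (j : 'I_d) : O (a * th ^+ j) by apply: OM => //; apply: OX; exact: th_int.
have [u Eu] := choice (fun j => HD _ (Oath j)).
pose A : 'M[int]_d := \matrix_(j, k) u j 0 k.
have zlA w : int_comb (w *m A) = D%:~R * (a * int_comb w).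
  have -> : w *m A = \sum_j (w 0 j) *: u j.
    apply/rowP => k; rewrite !mxE summxE; apply: eq_bigr => j _; by rewrite !mxE.
  rewrite mulrA mulr_sumr; elim/big_rec2: _ => [|j y v _ IH].
    by rewrite /int_comb big1 // => k _; rewrite mxE mul0r.
  rewrite int_combD IH; congr (_ + _).
  transitivity ((w 0 j)%:~R * int_comb (u j)).
    rewrite /int_comb mulr_sumr; apply: eq_bigr => k _; by rewrite mxE rmorphM mulrA.
  by rewrite -Eu; ring.
have [g Eg] := choice (fun k => HD _ (Of k)).
have detA : (\det A)%:~R = emb_norm (D%:~R * a).
  have v0 : \det embmx != 0 by have := embmx_unit fr; rewrite unitmxE unitfE.
  have E : embmx *m (map_mx intr A)^T = diag_mx (\row_i emb i (D%:~R * a)) *m embmx.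
    rewrite mul_diag_mx; apply/matrixP => i j; rewrite !mxE -rmorphXn -rmorphM -mulrA Eu.
    rewrite emb_int_comb mxE; apply: eq_bigr => k _; by rewrite !mxE.
  have := congr1 determinant E; rewrite !det_mulmx det_tr det_diag det_map_mx mulrC.
  move=> /(mulIf v0) ->; by apply: eq_bigr => i _; rewrite mxE.
have ndet : (`|\det A|%N)%:R = `|(\det A)%:~R| :> algC by rewrite -intr_norm.
have A0 : \det A != 0.
  by rewrite -(intr_eq0 algC) detA emb_norm_eq0 mulf_eq0 negb_or D0F.
have := @rows_mod_matrix d A m g A0.
rewrite -(ler_nat algC) ndet detA emb_normM normrM.
have -> : `|emb_norm D%:~R| = (`|D| ^ d)%N%:R :> algC.
  rewrite /emb_norm normr_prod (eq_bigr (fun=> `|D|%N%:R)) ?prodr_const ?card_ord ?natrX //.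
  by move=> i _; rewrite rmorph_int -intr_norm.
apply=> k l kl w E; apply: (fN k l kl (int_comb w) (O_int_comb w)).
by apply: (mulfI D0F); rewrite mulrBr !Eg -int_combB E zlA.
Qed.

(** The inverse of the matrix of the embeddings recovers from the conjugates
    of y the coordinates of a fixed multiple of y, which are integers. *)
Lemma bounded_finite (B : nat) : exists A : seq F, forall y, O y ->
  (forall i, `|emb i y| <= B%:R) -> y \in A.
Proof.
have [D D0 HD] := bounded_denominator fr.
have D0F : D%:~R != 0 :> F by rewrite intrF_eq0.
pose W := \sum_i \sum_j `|(invmx embmx) i j| * (`|D|%N * B)%:R.
have W0 : 0 <= W by do 2!apply: sumr_ge0 => ? _; rewrite mulr_ge0.
pose M := (Num.truncn W).+1.
have WM : W < M%:R by case/andP: (truncn_itv W0).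
pose A := [seq int_comb (\row_j ((f j : 'I_(M + M))%:Z - M%:Z)) / D%:~R
  | f : {ffun 'I_d -> 'I_(M + M)}].
exists A => y Oy yB; have [u Eu] := HD y Oy.
have EV : (map_mx intr u)^T = invmx embmx *m (\col_i emb i (D%:~R * y)).
  apply: (canRL (mulKmx (embmx_unit fr))); apply/matrixP => i k.
  by rewrite (ord1 k) -emb_int_comb Eu mxE.
have ub j : `|(u 0 j)%:~R| <= W :> algC.
  have -> : (u 0 j)%:~R = ((map_mx intr u)^T) j 0 :> algC by rewrite !mxE.
  rewrite EV mxE (le_trans (ler_norm_sum _ _ _)) //.
  rewrite /W [leRHS](bigD1 j) //=; apply: ler_wpDr.
    by do 2!apply: sumr_ge0 => ? _; rewrite mulr_ge0.
  apply: ler_sum => k _; rewrite normrM ler_wpM2l // mxE rmorphM rmorph_int normrM natrM.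
  by rewrite ler_pM // -intr_norm.
have uM j : `|u 0 j| < M%:Z.
  by rewrite -(ltr_int algC) intr_norm (le_lt_trans (ub j)).
have lt2 j : (absz (u 0 j + M%:Z)%R < M + M)%N.
  have := uM j; lia.
apply/fintype.imageP; exists [ffun j => Ordinal (lt2 j)] => //.
apply: (mulIf D0F); rewrite divfK // mulrC Eu; congr int_comb.
apply/rowP => j; rewrite !mxE ffunE /=; have := uM j; lia.
Qed.
End Lattice2.

(** * Small values of linear forms *)

Lemma norm_Re_le (z : algC) : `|'Re z| <= `|z|.
Proof.
rewrite -ler_sqr ?nnegrE // (normC2_Re_Im z) real_normK ?Creal_Re // lerDl.
by rewrite real_exprn_even_ge0 ?Creal_Im.
Qed.
Lemma norm_Im_le (z : algC) : `|'Im z| <= `|z|.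
Proof.
rewrite -ler_sqr ?nnegrE // (normC2_Re_Im z) real_normK ?Creal_Im // lerDr.
by rewrite real_exprn_even_ge0 ?Creal_Re.
Qed.
Lemma norm_le_Re_Im (z : algC) : `|z| <= `|'Re z| + `|'Im z|.
Proof. by rewrite {1}[z]Crect (le_trans (ler_normD _ _)) // normrM normCi mul1r. Qed.

Section Minkowski.
Variables (F : fieldExtType rat) (fr : frame F).
Local Notation O := (ring_of_integers F).
Local Notation d := (dg fr).
Local Notation th := (th fr).
Local Notation emb := (emb (f := fr)).
Local Notation cj := (cj (f := fr)).
Local Notation int_comb := (@int_comb F fr).

(** One real linear form for each embedding. A pair of conjugate embeddings
    contributes a real part and an imaginary part, distributed by comparing
    the two indices; a real embedding contributes its value. Taking both parts
    of every embedding would give twice as many forms as the rank of the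
    lattice. *)
Definition real_form (i : 'I_d) (x : F) : algC :=
  if (i <= cj i)%N then 'Re (emb i x) else 'Im (emb i x).

Lemma real_form_real i x : real_form i x \is Num.real.
Proof. by rewrite /real_form; case: ifP => _; rewrite ?Creal_Re ?Creal_Im. Qed.

Lemma real_formB i x y : real_form i (x - y) = real_form i x - real_form i y.
Proof. by rewrite /real_form rmorphB !raddfB; case: ifP. Qed.

Lemma real_form_le i x : `|real_form i x| <= `|emb i x|.
Proof. by rewrite /real_form; case: ifP => _; rewrite ?norm_Re_le ?norm_Im_le. Qed.

Lemma emb_le_real_form i x : `|emb i x| <= `|real_form i x| + `|real_form (cj i) x|.
Proof.
have ReE : 'Re (emb (cj i) x) = 'Re (emb i x) by rewrite emb_cj Re_conj.
have ImE : 'Im (emb (cj i) x) = - 'Im (emb i x) by rewrite emb_cj Im_conj.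
have := norm_le_Re_Im (emb i x).
rewrite /real_form cjK ReE ImE.
case: (ltngtP i (cj i)) => [_|_|/val_inj Ei]; first by rewrite normrN.
  by rewrite addrC.
have /eqP : 'Im (emb i x) = - 'Im (emb i x) by rewrite -ImE -Ei.
rewrite -addr_eq0 -mulr2n mulrn_eq0 /= => /eqP ->; rewrite normr0 addr0 => h.
by rewrite (le_trans h) // lerDl.
Qed.

(** Pigeonhole principle for the (X+1)^d combinations of the powers of th
    with coefficients between 0 and X. The i-th form takes values of size at
    most X mu_i, so that the values lie in at most the product of the
    4 X mu_i / c_i boxes with sides c_i. Each box is divided further by cls,
    which in applications is the class modulo a subgroup of index N. The
    hypothesis on the volume says that these are fewer than X^d parts. *)
Lemma minkowski : exists2 kappa : algC, 0 < kappa &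
  forall (N : nat) (cls : F -> 'I_N) (c : 'I_d -> algC),
  (forall i, 0 < c i) -> (forall i, c (cj i) = c i) ->
  N%:R * kappa < \prod_i c i ->
  exists x y, [/\ O x, O y, cls x = cls y, x <> y &
    forall i, `|emb i (x - y)| <= 2 * c i].
Proof.
pose mu i := 1 + \sum_j `|emb i th ^+ (j : 'I_d)|.
have mu1 i : 1 <= mu i by rewrite lerDl sumr_ge0.
have mu0 i : 0 < mu i by exact: lt_le_trans (mu1 i).
exists (\prod_i (4 * mu i)); first by apply: prodr_gt0 => i _; rewrite mulr_gt0.
move=> N cls c c0 cc volume.
have cr i : c i \is Num.real by rewrite gtr0_real.
(* so large that S i >= 1: rounding the number of boxes up at most doubles it *)
pose X := (\sum_i (Num.truncn (c i / mu i)).+1).+1.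
have XE i : c i <= X%:R * mu i.
  rewrite -ler_pdivrMr //; apply: (@le_trans _ _ (Num.truncn (c i / mu i)).+1%:R).
    by case/andP: (truncn_itv (ltW (divr_gt0 (c0 i) (mu0 i)))) => _ /ltW.
  rewrite ler_nat /X (bigD1 i) //=; lia.
pose S i := X%:R * mu i / c i.
have S1 i : 1 <= S i by rewrite ler_pdivlMr // mul1r.
have S0 i : 0 <= S i by exact: le_trans (S1 i).
(* the i-th form divided by c i lies strictly between - B i and B i *)
pose B i := (Num.truncn (S i)).+1.
have SB i : S i < (B i)%:R by case/andP: (truncn_itv (S0 i)).
have BS i : (B i + B i)%:R <= 4 * S i.
  have : (Num.truncn (S i))%:R <= S i by case/andP: (truncn_itv (S0 i)).
  have -> : 4 * S i = (S i + S i) + (S i + S i) by ring.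
  by rewrite natrD /B -natr1 => h; apply: lerD; apply: lerD.
pose pt (t : {ffun 'I_d -> 'I_X.+1}) : F := int_comb (\row_j (t j)%:Z).
have pt_inj : injective pt.
  move=> t u /int_comb_inj /rowP E; apply/ffunP => j; have := E j; rewrite !mxE.
  by case=> /val_inj.
have pt_le t i : `|emb i (pt t)| <= X%:R * mu i.
  rewrite emb_int_comb mxE (le_trans (ler_norm_sum _ _ _)) // /mu mulrDr mulr1 ler_wpDl //.
  rewrite mulr_sumr; apply: ler_sum => j _; rewrite !mxE normrM mulrC ler_wpM2r //.
  by rewrite -[_%:~R]/((t j : nat)%:R) normr_nat ler_nat -ltnS.
pose y t i := real_form i (pt t) / c i.
have yr t i : y t i \is Num.real by rewrite realM ?real_form_real // realV.
have yS t i : `|y t i| <= S i.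
  rewrite normrM normfV (gtr0_norm (c0 i)) ler_pM2r ?invr_gt0 //.
  exact: le_trans (real_form_le _ _) (pt_le t i).
pose w t i := Num.floor (y t i) + (B i)%:Z.
have w_ge0 t i : 0 <= w t i.
  rewrite -lerBlDr sub0r real_floor_ge_int_tmp // rmorphN /=.
  have := yS t i; rewrite real_ler_norml // => /andP [h _].
  apply: le_trans h; rewrite lerN2; exact: ltW.
have w_lt t i : w t i < (B i + B i)%N%:Z.
  rewrite PoszD ltrD2r -(ltr_int algC).
  have /andP [h _] := real_floor_itv (yr t i).
  apply: (le_lt_trans h); apply: le_lt_trans (SB i).
  by have := yS t i; rewrite real_ler_norml // => /andP [].
(* coordinate 0 records the class, the others the box *)
pose b (i : 'I_d.+1) : nat := if unlift ord0 i is Some j then (B j + B j)%N else N.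
pose f (t : {ffun 'I_d -> 'I_X.+1}) (i : 'I_d.+1) : nat :=
  if unlift ord0 i is Some j then absz (w t j) else cls (pt t).
have prod_lt : (\prod_i b i < #|{: {ffun 'I_d -> 'I_X.+1}}|)%N.
  rewrite card_ffun !card_ord big_ord_recl /b unlift_none.
  under eq_bigr => j _ do rewrite liftK.
  apply: (@leq_trans (X ^ d)%N); last by case: (dg fr) => [|e] //; rewrite leq_exp2r.
  rewrite -(ltr_nat algC) natrM natrX natr_prod.
  have P0 : 0 < \prod_i c i by apply: prodr_gt0 => i _.
  apply: (@le_lt_trans _ _ (N%:R * \prod_i (4 * S i))).
    by rewrite ler_wpM2l // ler_prod // => i _; rewrite ler0n BS.
  rewrite (_ : \prod_i _ = (\prod_i (4 * mu i)) * X%:R ^+ d / \prod_i c i); last first.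
    rewrite -[d in X%:R ^+ d]card_ord -prodr_const -prodfV -!big_split /=.
    by apply: eq_bigr => i _; rewrite /S; ring.
  rewrite !mulrA ltr_pdivrMr // mulrC.
  by rewrite ltr_pM2l ?exprn_gt0 // ltr0n.
have [[t [u [tu E]]]|none] := pselect (exists t u, t <> u /\ forall i, f t i = f u i); last first.
  move: prod_lt; rewrite ltnNge => /negP; case; apply: (@box_pigeonhole _ _ _ f).
    move=> t i; rewrite /f /b; case: (unlift _ _) => [j|] //.
    by rewrite -ltz_nat gez0_abs.
  by move=> t u E; apply: contrapT => tu; apply: none; exists t, u.
exists (pt t), (pt u); split; [exact: O_int_comb|exact: O_int_comb| | |].
- by have := E ord0; rewrite /f unlift_none => /val_inj.
- by move/pt_inj.
have form_lt i : `|real_form i (pt t - pt u)| <= c i.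
  have := E (lift ord0 i); rewrite /f liftK => /(congr1 Posz); rewrite !gez0_abs // => /addIr Ew.
  have /andP [h1 h2] := real_floor_itv (yr t i).
  have /andP [h3 h4] := real_floor_itv (yr u i).
  have -> : real_form i (pt t - pt u) = (y t i - y u i) * c i.
    by rewrite real_formB /y -mulrBl divfK ?gt_eqF.
  rewrite normrM (gtr0_norm (c0 i)) ler_piMl ?(ltW (c0 i)) //.
  move: h1 h2 h3 h4; rewrite Ew rmorphD /= => h1 h2 h3 h4.
  rewrite real_ler_norml ?realB //; apply/andP; split.
    by rewrite lerBrDl lerBlDr ltW // (lt_le_trans h4) // lerD2r.
  by rewrite lerBlDr addrC ltW // (lt_le_trans h2) // lerD2r.
move=> i; rewrite (le_trans (emb_le_real_form _ _)) // mulr_natl mulr2n lerD //.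
by rewrite -[leRHS]cc.
Qed.
End Minkowski.

(** * Finite indices and residues *)

(** Ideals that contain a fixed element a <> 0 are compared by the number of
    residues modulo a that they contain; this turns a maximality property of
    that number into an inclusion. *)
Lemma sub_count_eq (T : eqType) (p q : pred T) (s : seq T) :
  {in s, forall x, p x -> q x} -> (count q s <= count p s)%N ->
  {in s, forall x, q x -> p x}.
Proof.
elim: s => [//|x s IH] /= pq.
have pq' : {in s, forall y, p y -> q y} by move=> y ys; apply: pq; rewrite inE ys orbT.
have pqx : p x -> q x by apply: pq; rewrite inE eqxx.
have le : (count p s <= count q s)%N.
  elim: (s) pq' => //= y r IHr pqr; apply: leq_add.
    by case py: (p y) => //; rewrite pqr // inE eqxx.
  by apply: IHr => z zr; apply: pqr; rewrite inE zr orbT.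
move=> le2 y; rewrite inE => /predU1P [->|ys].
  by move=> qx; move: le2; rewrite qx; case: (p x) => //; lia.
apply: IH ys => //; move: le2 pqx; case: (p x); case: (q x) => //= ; lia.
Qed.

Section Index.
Variable F : zmodType.
Implicit Types A B C : set F.

Definition subgroup B := B 0 /\ forall x y, B x -> B y -> B (x - y).

Lemma subgroupN B x : subgroup B -> B x -> B (- x).
Proof. by move=> [B0 BB] Bx; rewrite -sub0r; apply: BB. Qed.
Lemma subgroupD B x y : subgroup B -> B x -> B y -> B (x + y).
Proof. by move=> gB Bx By; rewrite -[y]opprK; apply: gB.2 => //; apply: subgroupN. Qed.

Definition incongruent A B (s : seq F) :=
  [/\ uniq s, forall x, x \in s -> A x &
      forall x y, x \in s -> y \in s -> B (x - y) -> x = y].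

Definition has_index A B N := exists s, [/\ size s = N, incongruent A B s &
  forall x, A x -> exists2 r, r \in s & B (x - r)].

(** An incongruent list of maximal length represents every class. *)
Lemma has_index_exists A B n : subgroup B ->
  (forall s, incongruent A B s -> size s <= n)%N ->
  exists2 N, (N <= n)%N & has_index A B N.
Proof.
move=> gB bound.
pose p m := `[< exists2 s, incongruent A B s & size s = m >].
have p0 : p 0%N by apply/asboolP; exists [::].
have pn m : p m -> (m <= n)%N by move=> /asboolP [s /bound + <-].
case: (@ex_maxnP p n (ex_intro (fun m => p m) 0%N p0) pn) => N pN maxN.
exists N; first exact: pn.
move: pN => /asboolP [s [us As Bs] sN]; exists s; split=> // x Ax.
apply: contrapT => none.
have xs r : r \in s -> ~ B (x - r) by move=> rs Bxr; apply: none; exists r.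
suff /maxN : p (size s).+1 by rewrite sN ltnn.
apply/asboolP; exists (x :: s) => //; split.
- rewrite /= us andbT; apply/negP => /xs; apply; rewrite subrr; exact: gB.1.
- by move=> y; rewrite inE => /predU1P [->|/As].
- move=> y z; rewrite !inE => /predU1P [->|ys] /predU1P [->|zs] // h.
  + by case: (xs z).
  + by case: (xs y) => //; rewrite -opprB; apply: subgroupN.
  + exact: Bs.
Qed.

Lemma incongruent_le A B N s : subgroup B -> has_index A B N ->
  incongruent A B s -> (size s <= N)%N.
Proof.
move=> gB [t [<- _ cov]] [us As Bs].
have repr x : exists r, x \in s -> r \in t /\ B (x - r).
  have [/As/cov [r rt Br]|_] := boolP (x \in s); first by exists r.
  by exists 0.
have [f Hf] := choice repr.
rewrite -(size_map f); apply: uniq_leq_size.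
  rewrite map_inj_in_uniq // => x y xs ys E; apply: Bs => //.
  have [_ Bx] := Hf x xs; have [_ By] := Hf y ys.
  have -> : x - y = (x - f x) - (y - f y) by rewrite E opprB addrA subrK.
  exact: gB.2.
by move=> y /mapP [x /Hf [ft _] ->].
Qed.

Lemma has_index_mul A B C M N : subgroup A -> subgroup B -> subgroup C ->
  B `<=` A -> C `<=` B ->
  has_index A B M -> has_index B C N -> has_index A C (M * N).
Proof.
move=> gA gB gC BA CB [s [<- [us As Bs] sc]] [t [<- [ut Bt Ct] tc]].
have inj x y x' y' : x \in s -> x' \in s -> y \in t -> y' \in t ->
    C ((x + y) - (x' + y')) -> x = x' /\ y = y'.
  move=> xs xs' yt yt' Cxy; have Exx : x = x'.
    apply: Bs => //.
    have -> : x - x' = ((x + y) - (x' + y')) + (y' - y).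
      by rewrite opprD [x + y + _]addrACA -(addrA (x - x')) (addrA (y - y')) subrK subrr addr0.
    by apply: subgroupD => //; [apply: CB | apply: gB.2; apply: Bt].
  split=> //; apply: Ct => //; move: Cxy; rewrite Exx opprD addrACA subrr add0r //.
exists [seq x + y | x <- s, y <- t]; split.
- by rewrite size_allpairs.
- split.
  + apply: allpairs_uniq => // -[x y] [x' y'] /allpairsP [[a b] /= [as_ bt [-> ->]]].
    move=> /allpairsP [[a' b'] /= [as' bt' [-> ->]]] E.
    by have [|-> ->] := inj _ _ _ _ as_ as' bt bt'; rewrite ?E ?subrr //; apply: gC.1.
  + move=> z /allpairsP [[x y] /= [xs yt ->]].
    by apply: subgroupD => //; [apply: As | apply/BA/Bt].
  + move=> z z' /allpairsP [[x y] /= [xs yt ->]] /allpairsP [[x' y'] /= [xs' yt' ->]].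
    by move=> /(inj _ _ _ _ xs xs' yt yt') [-> ->].
- move=> z Az; have [x xs Bx] := sc z Az; have [y yt Cy] := tc _ Bx.
  exists (x + y); first by apply: allpairs_f.
  by rewrite opprD addrA.
Qed.
End Index.

Section Residues.
Variable F : fieldExtType rat.
Local Notation O := (ring_of_integers F).

Definition principal (a : F) : set F := [set a * y | y in O].

Lemma O_subgroup : subgroup O.
Proof. by split; [exact: O0 | exact: OB]. Qed.

Lemma principal_subgroup a : subgroup (principal a).
Proof.
split; first by exists 0; [exact: O0 | rewrite mulr0].
by move=> _ _ [x Ox <-] [y Oy <-]; exists (x - y); [exact: OB | rewrite mulrBr].
Qed.

Lemma index_principal_le (fr : frame F) : exists C : nat, forall a, O a -> a != 0 ->
  forall s, incongruent O (principal a) s -> (size s)%:R <= C%:R * `|emb_norm fr a|.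
Proof.
have [C HC] := index_principal fr; exists C => a Oa a0 s [us Os ins].
apply: (HC a Oa a0 _ (fun k : 'I_(size s) => s`_k)) => [k|k l kl y Oy E].
  by apply: Os; rewrite mem_nth.
move: kl; apply/negP; rewrite negbK -(inj_eq val_inj) -(nth_uniq 0 (ltn_ord k) (ltn_ord l) us).
apply/eqP; apply: (ins _ _ (mem_nth 0 (ltn_ord k)) (mem_nth 0 (ltn_ord l))).
by exists y.
Qed.

Lemma finite_index_principal a : O a -> a != 0 -> exists N, has_index O (principal a) N.
Proof.
move=> Oa a0; have [fr _] := frame_exists F.
have [C HC] := index_principal_le fr.
have bound s : incongruent O (principal a) s ->
    (size s <= Num.truncn (C%:R * `|emb_norm fr a|))%N.
  move=> inc; have h := HC a Oa a0 s inc.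
  rewrite -ltnS -(ltr_nat algC) (le_lt_trans h) //.
  by case/andP: (truncn_itv (le_trans (ler0n _ _) h)).
have [N _ HN] := has_index_exists (principal_subgroup a) bound.
by exists N.
Qed.

Lemma residues a : O a -> a != 0 -> exists2 s : seq F, (forall r, r \in s -> O r) &
  forall x, O x -> exists2 r, r \in s & principal a (x - r).
Proof.
by move=> Oa a0; have [N [s [_ [_ Os _] sc]]] := finite_index_principal Oa a0; exists s.
Qed.

Lemma residue_pigeonhole a (f : nat -> F) : O a -> a != 0 -> (forall i, O (f i)) ->
  exists i j, (i < j)%N /\ principal a (f i - f j).
Proof.
move=> Oa a0 Of; have [N HN] := finite_index_principal Oa a0.
apply: contrapT => none.
have fN i j : principal a (f i - f j) -> i = j.
  move=> pa; case: (ltngtP i j) => // ij; case: none; first by exists i, j.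
  exists j, i; split=> //; rewrite -opprB; apply: subgroupN => //; exact: principal_subgroup.
have finj : injective f.
  by move=> i j E; apply: fN; rewrite E subrr; exact: (principal_subgroup a).1.
have := @incongruent_le _ O (principal a) N (mkseq f N.+1) (principal_subgroup a) HN.
rewrite size_mkseq ltnn; case/(_ _)/notF; split.
- by rewrite mkseq_uniq.
- by move=> x /mapP [i _ ->].
- by move=> x y /mapP [i _ ->] /mapP [j _ ->] /fN ->.
Qed.

Lemma residue_power a y : O a -> a != 0 -> O y ->
  exists i m, (0 < m)%N /\ principal a (y ^+ i * (1 - y ^+ m)).
Proof.
move=> Oa a0 Oy; have [i [j [ij pa]]] := residue_pigeonhole Oa a0 (fun i => OX i Oy).
exists i, (j - i)%N; split; first by rewrite subn_gt0.
by rewrite mulrBr mulr1 -exprD subnKC // ltnW.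
Qed.

(** The ring O is completely integrally closed. Two of the a g^k are congruent
    modulo a, so that g^i - g^j is in O for some i < j; this is a monic
    equation for g with coefficients in O. *)
Lemma almost_integral a g : a != 0 -> (forall k, O (a * g ^+ k)) -> O g.
Proof.
move=> a0 H; have Oa : O a by have := H 0%N; rewrite expr0 mulr1.
have [i [j [ij [y Oy Ey]]]] := residue_pigeonhole Oa a0 H.
have Ey' : y = g ^+ i - g ^+ j by apply: (mulfI a0); rewrite Ey mulrBr.
pose p : {poly F} := 'X^j - ('X^i - y%:P).
apply: (@Oroot _ p).
- rewrite monicE /p lead_coefDl ?lead_coefXn // size_polyN size_polyXn.
  apply: (leq_ltn_trans (size_polyD _ _)); rewrite gtn_max size_polyN size_polyXn ltnS ij /=.
  by rewrite ltnS (leq_trans (size_polyC_leq1 _)) // (leq_ltn_trans _ ij).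
- by rewrite /root /p !hornerE Ey'; apply/eqP; ring.
- move=> k; rewrite /p !(coefB, coefC, coefXn).
  apply: OB; first exact: (Oint F (k == j)).
  by apply: OB; [exact: (Oint F (k == i)) | case: ifP => _ //; exact: O0].
Qed.
End Residues.

(** * Primes and their valuations *)

Section Primes.
Variable F : fieldExtType rat.
Local Notation O := (ring_of_integers F).
Implicit Types (P Q I : set F) (x y a : F).

Lemma ideal_subgroup I : is_ideal I -> subgroup I.
Proof.
move=> [_ I0 ID IM]; split=> // x y Ix Iy; apply: ID => //.
by rewrite -mulN1r; apply: IM => //; exact: (ON (O1 F)).
Qed.

Lemma prime_sub P x : is_prime P -> P x -> O x.
Proof. by move=> [[PO _ _ _] _ _ _]; apply: PO. Qed.
Lemma prime0 P : is_prime P -> P 0.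
Proof. by move=> [[_ ? _ _] _ _ _]. Qed.
Lemma primeB P x y : is_prime P -> P x -> P y -> P (x - y).
Proof. by move=> [/ideal_subgroup gP _ _ _]; apply: gP.2. Qed.
Lemma primeD P x y : is_prime P -> P x -> P y -> P (x + y).
Proof. by move=> [[_ _ PD _] _ _ _]; apply: PD. Qed.
Lemma primeM P x y : is_prime P -> O x -> P y -> P (x * y).
Proof. by move=> [[_ _ _ PM] _ _ _]; apply: PM. Qed.
Lemma primeMN P x y : is_prime P -> O x -> O y -> ~ P x -> ~ P y -> ~ P (x * y).
Proof. by move=> [_ _ _ pr] Ox Oy nx ny /pr []. Qed.
Lemma prime1 P : is_prime P -> ~ P 1.
Proof. by move=> [_ _ ? _]. Qed.
Lemma primeXN P x n : is_prime P -> O x -> ~ P x -> ~ P (x ^+ n).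
Proof.
move=> hP Ox nx; elim: n => [|n IH]; first by rewrite expr0; exact: prime1.
by rewrite exprS; apply: primeMN => //; exact: OX.
Qed.

Lemma prime_nonzero P : is_prime P -> exists2 a, P a & a != 0.
Proof.
move=> hP; apply: contrapT => none; case: hP => hI /eqP hN _ _; case/eqP: hN.
apply/seteqP; split=> x /= => [Px|->]; last by case: hI.
by apply: contrapT => /eqP x0; apply: none; exists x.
Qed.

Lemma prime_pigeonhole P a y : is_prime P -> P a -> a != 0 -> O y ->
  exists i m, (0 < m)%N /\ principal a (y ^+ i * (1 - y ^+ m)).
Proof. by move=> hP Pa; apply: residue_power; exact: prime_sub Pa. Qed.

(** The powers of y are eventually periodic modulo a nonzero element of P. *)
Lemma prime_inverse P y : is_prime P -> O y -> ~ P y ->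
  exists2 t, O t & P (1 - t * y).
Proof.
move=> hP Oy nPy; have [a Pa a0] := prime_nonzero hP.
have [i [m [m0 [z Oz Ez]]]] := prime_pigeonhole hP Pa a0 Oy.
exists (y ^+ m.-1); first exact: OX.
rewrite -exprSr prednK //.
have : P (y ^+ i * (1 - y ^+ m)) by rewrite -Ez mulrC; apply: primeM.
have [_ _ _ pr] := hP => /pr [||/(primeXN hP Oy nPy)|] //; first exact: OX.
by apply: OB; [exact: O1|exact: OX].
Qed.

(** If P were contained in Q, an element of Q outside P would be invertible
    modulo P, hence modulo Q. *)
Lemma prime_distinct P Q : is_prime P -> is_prime Q -> P <> Q -> exists2 t, P t & ~ Q t.
Proof.
move=> hP hQ PQ; apply: contrapT => none; apply: PQ; apply/seteqP; split=> y.
  by move=> Py; apply: contrapT => nQy; apply: none; exists y.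
move=> Qy; apply: contrapT => nPy.
have PQ z : P z -> Q z by move=> Pz; apply: contrapT => nQz; apply: none; exists z.
have [t Ot Pt] := prime_inverse hP (prime_sub hQ Qy) nPy.
apply: (prime1 hQ); rewrite -(subrK (t * y) 1).
by apply: primeD => //; [exact: PQ | exact: primeM].
Qed.

(** P is an associated prime of the finite ring O/aO. Among the b that do not
    vanish in the localization of O/aO at P, take one with the largest
    annihilator. If some y in P did not kill it, then y b, and inductively
    every y^k b, would be nonzero in the localization with the same
    annihilator as b. But the powers of y are eventually periodic modulo a, so
    that y^i b is killed by some 1 - y^m, which lies outside P. *)
Lemma prime_annihilator P : is_prime P -> exists a b,
  [/\ O a, a != 0, O b, ~ principal a b & forall y, P y -> principal a (y * b)].
Proof.
move=> hP; have [a Pa a0] := prime_nonzero hP; have Oa := prime_sub hP Pa.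
have [s Os sc] := residues Oa a0.
have aM z y : O z -> principal a y -> principal a (z * y).
  by move=> Oz [x Ox <-]; exists (z * x); [exact: OM | ring].
pose ann b := fun y : F => `[< principal a (y * b) >].
pose good b := O b /\ forall t, O t -> ~ P t -> ~ principal a (t * b).
pose p n := `[< exists2 b, good b & count (ann b) s = n >].
have good1 : good 1.
  split=> [|t Ot nPt]; first exact: O1.
  by rewrite mulr1 => -[y Oy Ey]; apply: nPt; rewrite -Ey mulrC; apply: primeM.
have p1 : exists n, p n by exists (count (ann 1) s); apply/asboolP; exists 1.
have pn n : p n -> (n <= size s)%N by move=> /asboolP [b _ <-]; exact: count_size.
case: (@ex_maxnP p (size s) p1 pn) => N /asboolP [b gb Eb] maxN.
have maxb b' : good b' -> (forall y, O y -> principal a (y * b) -> principal a (y * b')) ->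
    forall y, O y -> principal a (y * b') -> principal a (y * b).
  move=> gb' sub y Oy yb'; have [r rs ar] := sc y Oy.
  have Er c : y * c = r * c + c * (y - r) by ring.
  have rb' : principal a (r * b').
    rewrite (_ : r * b' = y * b' - b' * (y - r)); last by ring.
    by apply: (principal_subgroup a).2 => //; apply: aM => //; exact: gb'.1.
  have rb : ann b r.
    apply: (@sub_count_eq _ (ann b) (ann b') s) => //; last exact/asboolP.
      by move=> z zs /asboolP h; apply/asboolP/sub => //; exact: Os.
    by rewrite Eb; apply: maxN; apply/asboolP; exists b'.
  rewrite Er; apply: (subgroupD (principal_subgroup a)); first exact/asboolP.
  by apply: aM => //; exact: gb.1.
exists a, b; split=> //; first exact: gb.1.
  move=> h; apply: (gb.2 1) => //; [exact: O1|exact: prime1|by rewrite mul1r].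
move=> y Py; have Oy := prime_sub hP Py.
(* as t is outside P, b and t b have the same annihilator by maximality *)
suff [t [Ot nPt tyb]] : exists t, [/\ O t, ~ P t & principal a (y * (t * b))].
  apply: (maxb (t * b)) => //.
    split=> [|t' Ot' nPt']; first by apply: OM => //; exact: gb.1.
    by rewrite mulrA; apply: gb.2; [exact: OM | exact: primeMN].
  by move=> z Oz zb; rewrite mulrCA; exact: aM.
apply: contrapT => none.
have goody k : good (y ^+ k * b) /\ forall z, O z -> principal a (z * (y ^+ k * b)) ->
    principal a (z * b).
  elim: k => [|k [gk IHk]]; first by rewrite expr0 mul1r.
  have gyk : good (y ^+ k.+1 * b).
    split; first by apply: OM; [exact: OX | exact: gb.1].
    move=> t Ot nPt h; apply: none; exists t; split=> //.
    have Oyt : O (t * y) by exact: OM.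
    have -> : y * (t * b) = t * y * b by ring.
    apply: (IHk _ Oyt); have -> : t * y * (y ^+ k * b) = t * (y ^+ k.+1 * b) by rewrite exprS; ring.
    exact: h.
  split=> // z Oz h; apply: (maxb (y ^+ k.+1 * b)) => // w Ow wb.
  by rewrite mulrCA; apply: aM => //; exact: OX.
have [i [m [m0 h]]] := prime_pigeonhole hP Pa a0 Oy.
apply: (gb.2 (1 - y ^+ m)).
- by apply: OB; [exact: O1|exact: OX].
- move=> h1; apply: (prime1 hP); rewrite -(subrK (y ^+ m) 1); apply: primeD => //.
  by rewrite -(prednK m0) exprSr; apply: primeM => //; exact: OX.
- have [_ IH] := goody i; apply: IH; first by apply: OB; [exact: O1|exact: OX].
  have -> : (1 - y ^+ m) * (y ^+ i * b) = b * (y ^+ i * (1 - y ^+ m)) by ring.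
  by apply: aM => //; exact: gb.1.
Qed.

(** An element of the inverse ideal of P that is not in O. *)
Definition gamma_spec P (g : F) := ~ O g /\ forall y, P y -> O (g * y).

Lemma gamma_exists P : is_prime P -> exists g, gamma_spec P g.
Proof.
move=> /prime_annihilator [a [b [Oa a0 Ob nb Hb]]]; exists (b / a); split.
  by move=> Og; apply: nb; exists (b / a) => //; field.
move=> y /Hb [z Oz Ez]; suff -> : b / a * y = z by [].
by apply: (mulfI a0); rewrite Ez; field.
Qed.

Definition gamma P : F := xget 0 (gamma_spec P).

Lemma gammaP P : is_prime P -> gamma_spec P (gamma P).
Proof. by move=> /gamma_exists [g Hg]; apply: (xgetI 0 Hg). Qed.

Lemma gamma_neq0 P : is_prime P -> gamma P != 0.
Proof. by move=> /gammaP [h _]; apply/eqP => g0; apply: h; rewrite g0; exact: O0. Qed.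

(** Invertibility of P. If gamma P were contained in P, then a gamma^k would
    lie in O for every k and a fixed a in P, and gamma would be in O. *)
Lemma gamma_pi P : is_prime P -> exists pi, P pi /\ ~ P (gamma P * pi).
Proof.
move=> hP; have [ng gP] := gammaP hP; have [a Pa a0] := prime_nonzero hP.
apply: contrapT => none; apply: ng; apply: (almost_integral a0) => k.
have : P (a * gamma P ^+ k).
  elim: k => [|k IH]; first by rewrite expr0 mulr1.
  apply: contrapT => nP; apply: none; exists (a * gamma P ^+ k); split=> //.
  by rewrite mulrCA -exprS.
exact: prime_sub.
Qed.

Section OnePrime.
Variables (P : set F) (hP : is_prime P).
Let g := gamma P.

Definition locring : set F := [set x | exists y z, [/\ O y, O z, ~ P z & x = y / z]].
Definition locunit : set F := [set x | exists y z, [/\ O y, ~ P y, O z, ~ P z & x = y / z]].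

Let P0 : P 0 := prime0 hP.
Let nz z : ~ P z -> z != 0.
Proof. by move=> nPz; apply/eqP => z0; apply: nPz; rewrite z0. Qed.
Let g0 : g != 0 := gamma_neq0 hP.

Lemma locring_O x : O x -> locring x.
Proof. by move=> Ox; exists x, 1; split; [|exact: O1|exact: prime1|rewrite divr1]. Qed.

Lemma locringM x y : locring x -> locring y -> locring (x * y).
Proof.
move=> [a [b [Oa Ob nb ->]]] [c [e [Oc Oe ne ->]]]; exists (a * c), (b * e).
by split; [exact: OM|exact: OM|exact: primeMN|rewrite mulf_div].
Qed.

Lemma locring_subgroup : subgroup locring.
Proof.
split; first exact/locring_O/O0.
move=> _ _ [a [b [Oa Ob nb ->]]] [c [e [Oc Oe ne ->]]].
exists (a * e - c * b), (b * e); split; [|exact: OM|exact: primeMN|].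
  by apply: OB; exact: OM.
by field; rewrite !nz.
Qed.

Lemma locunit_locring x : locunit x -> locring x.
Proof. by move=> [a [b [Oa _ Ob nb ->]]]; exists a, b. Qed.

Lemma locunit_neq0 x : locunit x -> x != 0.
Proof. by move=> [a [b [Oa na Ob nb ->]]]; rewrite mulf_neq0 ?invr_eq0 ?nz. Qed.

Lemma locunitM x y : locunit x -> locunit y -> locunit (x * y).
Proof.
move=> [a [b [Oa na Ob nb ->]]] [c [e [Oc nc Oe ne ->]]]; exists (a * c), (b * e).
by split; [exact: OM|exact: primeMN|exact: OM|exact: primeMN|rewrite mulf_div].
Qed.

Lemma locunitV x : locunit x -> locunit x^-1.
Proof. by move=> [a [b [Oa na Ob nb ->]]]; exists b, a; rewrite invf_div. Qed.

Lemma locunit_O x : O x -> ~ P x -> locunit x.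
Proof. by move=> Ox nx; exists x, 1; split; [| |exact: O1|exact: prime1|rewrite divr1]. Qed.

Lemma locunit1 : locunit 1.
Proof. by apply: locunit_O; [exact: O1|exact: prime1]. Qed.

(** Here u = gamma pi lies in O outside P. If z gamma^n were in O with z
    outside P, multiplying by pi^n would put z u^n in P. *)
Lemma gammaX_notin n : (0 < n)%N -> ~ locring (g ^+ n).
Proof.
move=> n0 [y [z [Oy Oz nz' E]]]; have [pi [Ppi nu]] := gamma_pi hP.
have Ou : O (g * pi) by have [_] := gammaP hP; apply.
apply: (primeMN hP Oz (OX n Ou) nz' (primeXN (n := n) hP Ou nu)).
rewrite exprMn E mulrA [z * _]mulrC divfK ?nz //.
by apply: primeM => //; rewrite -(prednK n0) exprSr; apply: primeM => //;
  apply: OX; exact: prime_sub Ppi.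
Qed.

Lemma gammaV_locring : locring g^-1.
Proof.
have [pi [Ppi nu]] := gamma_pi hP; exists pi, (g * pi).
have Opi := prime_sub hP Ppi; split=> //; first by have [_] := gammaP hP; apply.
have pi0 : pi != 0 by apply/eqP => p0; move: nu; rewrite p0 mulr0.
by field; rewrite g0 pi0.
Qed.

(** An element of O is multiplied by gamma as long as it lies in P. This
    remains in O, and it stops because gamma is not in O. *)
Lemma pval_exists x : x != 0 -> exists k : int, locunit (x * g ^ k).
Proof.
have valO y : O y -> y != 0 -> exists k : nat, locunit (y * g ^+ k).
  move=> Oy y0; apply: contrapT => none.
  have Oyk k : O (y * g ^+ k) by
    elim: k => [|k IH]; [rewrite expr0 mulr1 | rewrite exprSr mulrA mulrC;
      have [_] := gammaP hP; apply; apply: contrapT => nP; apply: none; exists k; exact: locunit_O].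
  by have [ng _] := gammaP hP; apply: ng; exact: almost_integral Oyk.
move=> x0; have [m m0 Omx] := integral_multiple x.
have m0F : m%:~R != 0 :> F by rewrite intrF_eq0.
have [k hk] := valO _ Omx (mulf_neq0 m0F x0).
have [l hl] := valO _ (Oint F m) m0F.
exists (k%:Z - l%:Z).
have -> : x * g ^ (k%:Z - l%:Z) = m%:~R * x * g ^+ k * (m%:~R * g ^+ l)^-1.
  by rewrite expfzDr ?g0 // -invr_expz -!exprnP; field; rewrite m0F expf_neq0 ?g0.
by apply: locunitM => //; exact: locunitV.
Qed.
End OnePrime.

(** The normalization is that gamma has valuation -1. *)
Definition pval P x : int := xget 0 [set k : int | locunit P (x * gamma P ^ k)].
(** Since gamma has valuation -1, membership says that the valuation of x at P
    is at least k. Unlike pval, it gives 0 an infinite valuation, so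
    that each of these sets is a subgroup. *)
Definition val_ge P (k : int) : set F := [set x | locring P (x * gamma P ^ k)].

End Primes.

Section Valuation.
Variable F : fieldExtType rat.
Local Notation O := (ring_of_integers F).
Implicit Types (P Q I : set F) (x y a : F) (k l : int).

Section OnePrime.
Variables (P : set F) (hP : is_prime P).
Let g := gamma P.
Let g0 : g != 0 := gamma_neq0 hP.

Lemma pval_unit x : x != 0 -> locunit P (x * g ^ pval P x).
Proof.
move=> /(pval_exists hP).
exact: (@xgetPex _ 0 [set k : int | locunit P (x * g ^ k)]).
Qed.

Lemma locring_gammaN n : locring P (g ^- n).
Proof.
rewrite -exprVn; elim: n => [|n IH]; first by rewrite expr0; apply/locring_O/O1.
by rewrite exprS; apply: locringM => //; exact: gammaV_locring.
Qed.

Lemma val_geP x k : x != 0 -> val_ge P k x <-> k <= pval P x.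
Proof.
move=> x0; have hu := pval_unit x0; rewrite /val_ge /=; split=> [h|le].
  rewrite leNgt; apply/negP => lt.
  have [n n0 En] : exists2 n : nat, (0 < n)%N & k = pval P x + n%:Z.
    by exists `|k - pval P x|%N; lia.
  apply: (@gammaX_notin _ P hP n) => //.
  have -> : g ^+ n = (x * g ^ k) * (x * g ^ pval P x)^-1.
    rewrite En expfzDr // -exprnP; have := expfz_neq0 (pval P x) g0.
    by move: (g ^ pval P x) => A A0; field; rewrite x0 A0.
  by apply: locringM => //; apply/locunit_locring/locunitV.
have [n En] : exists n : nat, pval P x = k + n%:Z by exists `|pval P x - k|%N; lia.
have -> : x * g ^ k = (x * g ^ pval P x) * g ^- n.
  by rewrite En expfzDr // -exprnP; move: (g ^ k) => A; rewrite mulrA mulfK ?expf_neq0.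
by apply: locringM; [|exact: locunit_locring|exact: locring_gammaN].
Qed.

Lemma pval_uniq x k : locunit P (x * g ^ k) -> pval P x = k.
Proof.
move=> hk; have x0 : x != 0.
  by have := locunit_neq0 hP hk; rewrite mulf_eq0 negb_or => /andP [].
have le : k <= pval P x by apply/val_geP => //; exact: locunit_locring.
have [n En] : exists n : nat, pval P x = k + n%:Z by exists `|pval P x - k|%N; lia.
case: n En => [|n] En; first by rewrite En addr0.
case: (@gammaX_notin _ P hP n.+1) => //.
have -> : g ^+ n.+1 = (x * g ^ pval P x) * (x * g ^ k)^-1.
  rewrite En expfzDr // -exprnP; have := expfz_neq0 k g0.
  by move: (g ^ k) => A A0; field; rewrite x0 A0.
by apply/locunit_locring/locunitM/locunitV => //; exact: pval_unit.
Qed.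

Lemma pvalM x y : x != 0 -> y != 0 -> pval P (x * y) = pval P x + pval P y.
Proof.
move=> x0 y0; apply: pval_uniq; rewrite expfzDr //.
rewrite mulrACA.
by apply: locunitM => //; exact: pval_unit.
Qed.

Lemma pval1 : pval P 1 = 0.
Proof. by apply: pval_uniq; rewrite expr0z mulr1; exact: locunit1. Qed.

Lemma pvalX x n : x != 0 -> pval P (x ^+ n) = n%:Z * pval P x.
Proof.
move=> x0; elim: n => [|n IH]; first by rewrite expr0 pval1 mul0r.
by rewrite exprS pvalM ?expf_neq0 // IH -addn1 PoszD; ring.
Qed.

Lemma val_ge_subgroup k : subgroup (val_ge P k).
Proof.
have [l0 lB] := locring_subgroup hP; split; rewrite /val_ge /=; first by rewrite mul0r.
by move=> x y; rewrite mulrBl; exact: lB.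
Qed.

Lemma val_ge0_locring x : val_ge P 0 x <-> locring P x.
Proof. by rewrite /val_ge /= expr0z mulr1. Qed.

Lemma val_ge_O x : O x -> val_ge P 0 x.
Proof. by move=> Ox; apply/val_ge0_locring/locring_O. Qed.

Lemma val_geM x y k l : val_ge P k x -> val_ge P l y -> val_ge P (k + l) (x * y).
Proof.
rewrite /val_ge /= => hx hy; rewrite expfzDr //.
rewrite mulrACA.
exact: locringM.
Qed.

Lemma val_ge_le x k l : k <= l -> val_ge P l x -> val_ge P k x.
Proof.
move=> kl; have [-> _|x0] := eqVneq x 0; first exact: (val_ge_subgroup k).1.
by rewrite !val_geP // => /(le_trans kl).
Qed.

Lemma prime_val_ge1 x : O x -> P x <-> val_ge P 1 x.
Proof.
move=> Ox; have [_ gO] := gammaP hP; rewrite /val_ge /= expr1z; split=> [Px|].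
  by apply: locring_O => //; rewrite mulrC; apply: gO.
move=> [y [z [Oy Oz nPz E]]]; have [pi [Ppi nu]] := gamma_pi hP.
have z0 : z != 0 by apply/eqP => z0; apply: nPz; rewrite z0; exact: prime0.
apply: contrapT => nPx.
apply: (primeMN hP Oz (OM Ox (gO _ Ppi)) nPz (primeMN hP Ox (gO _ Ppi) nPx nu)).
have -> : z * (x * (gamma P * pi)) = z * (x * gamma P) * pi by ring.
by rewrite E [z * _]mulrC divfK //; apply: primeM.
Qed.

Lemma pval_uniformizer : exists pi, [/\ P pi, pi != 0 & pval P pi = 1].
Proof.
have [pi [Ppi nu]] := gamma_pi hP; exists pi; split=> //.
  by apply/eqP => p0; apply: nu; rewrite p0 mulr0; exact: prime0.
apply: pval_uniq; rewrite expr1z mulrC; apply: locunit_O => //; have [_] := gammaP hP; exact.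
Qed.

Lemma pval_ge0 x : O x -> x != 0 -> 0 <= pval P x.
Proof. by move=> Ox x0; apply/val_geP => //; exact: val_ge_O. Qed.

Lemma pval_gt0 x : O x -> x != 0 -> P x <-> 0 < pval P x.
Proof. by move=> Ox x0; rewrite prime_val_ge1 // val_geP. Qed.

(** As gamma pi is invertible modulo P, some 1 - t gamma pi lies in P. Then x
    is the sum of x (1 - t gamma pi) and of (gamma x) (t pi), and all four
    factors are in P. *)
Lemma val_ge2_square x : O x -> val_ge P 2 x -> ideal_exp P 2 x.
Proof.
move=> Ox g2; have [_ gO] := gammaP hP.
have Px : P x by apply/prime_val_ge1 => //; exact: val_ge_le g2.
have Pgx : P (g * x).
  apply/prime_val_ge1; first exact: gO.
  move: g2; rewrite /val_ge /= expr1z -[2]/(1 + 1) expfzDr // !expr1z.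
  by rewrite -/g mulrA [x * g]mulrC.
have [pi [Ppi nu]] := gamma_pi hP.
have [t Ot Pt] := prime_inverse hP (gO _ Ppi) nu.
have -> : x = x * (1 - t * (g * pi)) + (g * x) * (t * pi) by ring.
have sub y z : P y -> P z -> ideal_exp P 2 (y * z).
  move=> Py Pz I [hI sI]; apply: sI; exists y => //; exists z => //.
  move=> J [hJ sJ]; apply: sJ; exists z => //; exists 1; first exact: O1.
  by rewrite mulr1.
move=> I hI; have [[_ _ ID _] _] := hI.
by apply: ID; apply: sub => //; exact: primeM.
Qed.

End OnePrime.

(** A proper ideal that contains I and is maximal among these is prime. There is
    one because such an ideal is determined by the residues modulo a that it
    contains, and these are finitely many. *)
Lemma maximal_above I a : is_ideal I -> I a -> a != 0 -> ~ I 1 ->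
  exists2 P, is_prime P & I `<=` P.
Proof.
move=> hI Ia a0 nI1; have Oa : O a by case: hI => IO _ _ _; exact: IO.
have [s Os sc] := residues Oa a0.
pose mu (J : set F) := count (fun r => `[< J r >]) s.
pose good J := [/\ is_ideal J, I `<=` J & ~ J 1].
pose p n := `[< exists2 J, good J & mu J = n >].
have p1 : exists n, p n by exists (mu I); apply/asboolP; exists I => //; split.
have pn n : p n -> (n <= size s)%N by move=> /asboolP [J _ <-]; exact: count_size.
case: (@ex_maxnP p (size s) p1 pn) => N /asboolP [M [hM IM nM1] EM] maxN.
have Msub := ideal_subgroup hM; have [MO M0 MD MM] := hM.
have Ma : M a by exact: IM.
exists M => //; split=> //.
  by move=> M00; move: Ma a0; rewrite M00 /= => ->; rewrite eqxx.
move=> x y Ox Oy Mxy; apply: contrapT => none.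
have nMx : ~ M x by move=> ?; apply: none; left.
pose J := [set z | exists m c, [/\ M m, O c & z = m + c * x]].
have hJ : is_ideal J.
  split.
  - by move=> _ [m [c [Mm Oc ->]]]; apply: OD; [exact: MO | exact: OM].
  - by exists 0, 0; split=> //; [exact: O0 | ring].
  - move=> _ _ [m [c [Mm Oc ->]]] [m' [c' [Mm' Oc' ->]]]; exists (m + m'), (c + c').
    by split; [exact: MD | exact: OD | ring].
  - move=> b _ Ob [m [c [Mm Oc ->]]]; exists (b * m), (b * c).
    by split; [exact: MM | exact: OM | ring].
have MJ : M `<=` J by move=> m Mm; exists m, 0; split=> //; [exact: O0 | ring].
have Jx : J x by exists 0, 1; split=> //; [exact: O1 | ring].
have [[m [c [Mm Oc E1]]]|nJ1] := pselect (J 1).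
  apply: none; right; have -> : y = y * m + c * (x * y) by rewrite -[LHS]mulr1 E1; ring.
  by apply: MD; exact: MM.
have gJ : good J by split=> //; exact: subset_trans MJ.
apply: nMx; have [r rs [z Oz Ez]] := sc x Ox.
have Jr : J r.
  have -> : r = x - z * a by rewrite [z * a]mulrC Ez; ring.
  by apply: (ideal_subgroup hJ).2 => //; case: hJ => _ _ _; apply => //; exact: MJ.
have /asboolP Mr : `[< M r >].
  apply: (@sub_count_eq _ (fun r => `[< M r >]) (fun r => `[< J r >]) s) => //; last exact/asboolP.
    by move=> w ws /asboolP h; apply/asboolP/MJ.
  by rewrite -/(mu J) -/(mu M) EM; apply: maxN; apply/asboolP; exists J.
have -> : x = r + z * a by rewrite [z * a]mulrC Ez; ring.
by apply: MD => //; exact: MM.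
Qed.

(** The s in O with s x in O form an ideal contained in no prime. *)
Lemma O_global x : (forall P, is_prime P -> val_ge P 0 x) -> O x.
Proof.
move=> loc; have [m m0 Omx] := integral_multiple x.
pose I := [set s | O s /\ O (s * x)].
have hI : is_ideal I.
  split.
  - by move=> s [].
  - by split; rewrite ?mul0r; exact: O0.
  - by move=> s t [Os Osx] [Ot Otx]; split; rewrite ?mulrDl; exact: OD.
  - by move=> b s Ob [Os Osx]; split; rewrite -?mulrA; exact: OM.
have [[_]|nI1] := pselect (I 1); first by rewrite mul1r.
have Im : I m%:~R by split; [exact: Oint|].
have m0F : m%:~R != 0 :> F by rewrite intrF_eq0.
have [P hP IP] := maximal_above hI Im m0F nI1.
have /val_ge0_locring [y [z [Oy Oz nPz E]]] := loc P hP.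
have z0 : z != 0 by apply/eqP => z0; apply: nPz; rewrite z0; exact: prime0.
by case: nPz; apply: IP; split=> //; rewrite E mulrC divfK.
Qed.

Lemma finite_primes_above a : O a -> a != 0 -> finite_set [set P | is_prime P /\ P a].
Proof.
move=> Oa a0; have [s Os sc] := residues Oa a0.
pose f (m : (size s).-tuple bool) : set F :=
  [set x | O x /\ exists2 r, r \in mask m s & principal a (x - r)].
apply: (@sub_finite_set _ _ (f @` setT)); last exact/finite_image/finite_finset.
move=> P [hP Pa].
exists (map_tuple (fun r => `[< P r >]) (in_tuple s)) => //.
have paP y : principal a y -> P y by move=> [z Oz <-]; rewrite mulrC; exact: primeM.
rewrite /f /= -filter_mask; apply/seteqP; split=> x /=.
  move=> [Ox [r]]; rewrite mem_filter => /andP [/asboolP Pr rs] /paP Pxr.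
  by rewrite -(subrK r x); apply: primeD.
move=> Px; have Ox := prime_sub hP Px; split=> //; have [r rs pr] := sc x Ox.
exists r => //; rewrite mem_filter rs andbT; apply/asboolP.
by rewrite -[r](subKr x); apply: primeB => //; exact: paP.
Qed.
End Valuation.

Section Morphism.
Variables (F1 F2 : fieldExtType rat) (f : {rmorphism F1 -> F2}).

Lemma O_morph x : ring_of_integers F1 x <-> ring_of_integers F2 (f x).
Proof.
have E : (fun n : int => f n%:~R) =1 (fun n => n%:~R) by move=> n; rewrite rmorph_int.
split=> -[p mp rp]; exists p => //.
  rewrite -(fmorph_root f) -map_poly_comp in rp.
  by rewrite -(eq_map_poly E).
by rewrite -(fmorph_root f) -map_poly_comp (eq_map_poly E).
Qed.

Variables (P : set F2) (hP : is_prime P).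
Let P1 : set F1 := f @^-1` P.

Lemma prime_preimage : is_prime P1.
Proof.
have [hI hN h1 hpr] := hP; have [IO I0 ID IM] := hI.
split.
- split=> [x Px|||a x Oa Px]; rewrite /P1 /preimage /=.
  + by apply/O_morph; exact: IO.
  + by rewrite rmorph0.
  + by move=> x y; rewrite rmorphD; exact: ID.
  + by rewrite rmorphM; apply: IM => //; exact/O_morph.
- move=> E; have [a Pa a0] := prime_nonzero hP.
  have [m m0 [y Oy Ey]] := O_dvd_int (prime_sub hP Pa) a0.
  have : P1 m%:~R by rewrite /P1 /preimage /= rmorph_int -Ey mulrC; exact: IM.
  by rewrite E /= => /eqP; rewrite intrF_eq0 (negPf m0).
- by rewrite /P1 /preimage /= rmorph1.
- move=> a b Oa Ob; rewrite /P1 /preimage /= rmorphM; apply: hpr; exact/O_morph.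
Qed.

(** The integer e is the ramification index. Any element is a unit at the prime
    below times a power of its gamma, and f preserves local units. *)
Lemma pval_morph : exists2 e : int, 0 < e & forall x, x != 0 -> pval P (f x) = e * pval P1 x.
Proof.
have hP1 := prime_preimage; have g0 := gamma_neq0 hP1.
have hu x : locunit P1 x -> locunit P (f x).
  move=> [a [b [Oa na Ob nb ->]]]; exists (f a), (f b); rewrite fmorph_div.
  by split=> //; exact/O_morph.
have vu x : locunit P x -> pval P x = 0.
  by move=> ux; apply: pval_uniq => //; rewrite expr0z mulr1.
pose e := - pval P (f (gamma P1)).
have vz (k : int) : pval P (f (gamma P1) ^ k) = - e * k.
  have fg0 : f (gamma P1) != 0 by rewrite fmorph_eq0.
  case: k => n; first by rewrite -exprnP pvalX // /e; ring.
  have h := pvalM hP (invr_neq0 (expf_neq0 n.+1 fg0)) (expf_neq0 n.+1 fg0).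
  move: h; rewrite mulVf ?expf_neq0 // pval1 // pvalX // => /esym/eqP; rewrite addr_eq0 => /eqP h.
  by rewrite NegzE -invr_expz -exprnP h /e; ring.
have E x : x != 0 -> pval P (f x) = e * pval P1 x.
  move=> x0; have := vu _ (hu _ (pval_unit hP1 x0)).
  rewrite rmorphM pvalM ?fmorph_eq0 ?expfz_neq0 // rmorphXz /= ?vz => [/eqP|].
    by rewrite addr_eq0 => /eqP ->; ring.
  by rewrite unitfE.
exists e => //; have [pi [Ppi pi0 vpi]] := pval_uniformizer hP1.
have := E pi pi0; rewrite vpi mulr1 => <-.
apply/pval_gt0 => //; rewrite ?fmorph_eq0 //; exact: (prime_sub hP Ppi).
Qed.
End Morphism.

(** * Indices of ideals *)

Section IdealIndex.
Variable F : fieldExtType rat.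
Local Notation O := (ring_of_integers F).
Implicit Types (P Q : set F) (ps : seq (set F)).

(** The product of the primes in ps, counted with multiplicity. *)
Definition multideal ps : set F :=
  [set x | O x /\ forall Q, is_prime Q -> val_ge Q (count_mem Q ps)%:Z x].

Definition prime_norm P : nat := xget 1%N [set N | has_index O P N].

Lemma prime_normP P : is_prime P -> has_index O P (prime_norm P).
Proof.
move=> hP; have [a Pa a0] := prime_nonzero hP; have Oa := prime_sub hP Pa.
have [N HN] := finite_index_principal Oa a0.
have gP : subgroup P by case: hP => /ideal_subgroup.
have bound s : incongruent O P s -> (size s <= N)%N.
  move=> [us Os Ps]; apply: (incongruent_le (principal_subgroup a) HN); split=> //.
  by move=> x y xs ys [z Oz Ez]; apply: Ps => //; rewrite -Ez mulrC; exact: primeM.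
have [M _ HM] := has_index_exists gP bound.
exact: (@xgetPex _ 1%N [set N | has_index O P N] (ex_intro _ M HM)).
Qed.

Lemma has_index_gt0 A B N : has_index A B N -> A (0 : F) -> (0 < N)%N.
Proof. by move=> [s [<- _ cov]] A0; have [r] := cov _ A0; case: s {cov}. Qed.

Lemma prime_norm_gt0 P : is_prime P -> (0 < prime_norm P)%N.
Proof. by move=> /prime_normP /has_index_gt0; apply; exact: O0. Qed.

Lemma multideal_subgroup ps : subgroup (multideal ps).
Proof.
split; first by split=> [|Q hQ]; [exact: O0 | exact: (val_ge_subgroup hQ _).1].
move=> x y [Ox Ix] [Oy Iy]; split=> [|Q hQ]; first exact: OB.
by apply: (val_ge_subgroup hQ _).2; [exact: Ix | exact: Iy].
Qed.

Lemma multidealM ps qs x y : multideal ps x -> multideal qs y -> multideal (ps ++ qs) (x * y).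
Proof.
move=> [Ox Ix] [Oy Iy]; split=> [|Q hQ]; first exact: OM.
by rewrite count_cat PoszD; apply: val_geM => //; [exact: Ix | exact: Iy].
Qed.

Lemma multideal_O x : O x -> multideal [::] x.
Proof. by move=> Ox; split=> // Q hQ; exact: val_ge_O. Qed.

(** A local generator at P of the product of the primes in ps: it is a product of
    uniformizers at P and of elements of the other primes outside P. *)
Lemma exact_element P ps : is_prime P -> (forall Q, Q \in ps -> is_prime Q) ->
  exists x, [/\ multideal ps x, x != 0 & pval P x = (count_mem P ps)%:Z].
Proof.
move=> hP; elim: ps => [|Q ps IH] hps.
  by exists 1; split; [exact/multideal_O/O1|exact: oner_neq0|rewrite pval1].
have [x [Ix x0 vx]] := IH (fun R Rps => hps R (mem_behead (s := Q :: ps) Rps)).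
have hQ : is_prime Q by apply: hps; rewrite inE eqxx.
have [t [Qt t0 vt]] : exists t, [/\ Q t, t != 0 & pval P t = (Q == P)%:Z].
  have [->|/eqP QP] := eqVneq Q P; first by have [pi [Ppi p0 v]] := pval_uniformizer hP; exists pi.
  have [t Qt nPt] := prime_distinct hQ hP QP.
  have t0 : t != 0 by apply/eqP => t0; apply: nPt; rewrite t0; exact: prime0.
  have Ot := prime_sub hQ Qt.
  exists t; split=> //; apply/eqP; rewrite eq_le pval_ge0 // andbT leNgt.
  by apply/negP => /(pval_gt0 hP Ot t0).
exists (t * x); split; last by rewrite pvalM // vt vx /= PoszD.
- have : multideal [:: Q] t.
    have Ot := prime_sub hQ Qt; split=> // R hR /=.
    have [EQ|_] := eqVneq Q R; last by exact: val_ge_O.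
    by rewrite -EQ; exact: (prime_val_ge1 hQ Ot).1.
  by move=> /multidealM; apply.
- exact: mulf_neq0.
Qed.

(** Multiplication by an exact element x identifies O/P with the quotient. For
    the surjectivity, z/x is integral at P, and every element integral at P
    is congruent modulo P to an element of O. *)
Lemma multideal_step P ps : is_prime P -> (forall Q, Q \in ps -> is_prime Q) ->
  has_index (multideal ps) (multideal (P :: ps)) (prime_norm P).
Proof.
move=> hP hps; have [s [<- [us Os Ps] cov]] := prime_normP hP.
have [x [Ix x0 vx]] := exact_element hP hps; have [Ox _] := Ix.
have cP : count_mem P (P :: ps) = (count_mem P ps).+1 by rewrite /= eqxx.
have Ixy y : O y -> multideal ps (x * y).
  by move=> Oy; rewrite -[ps]cats0; apply: multidealM => //; exact: multideal_O.
exists [seq x * y | y <- s]; split; first by rewrite size_map.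
  split.
  - by rewrite map_inj_uniq //; exact: mulfI.
  - by move=> _ /mapP [y /Os Oy ->]; exact: Ixy.
  - move=> _ _ /mapP [y ys ->] /mapP [z zs ->] [_ /(_ P hP)]; rewrite -mulrBr cP.
    have [->|yz] := eqVneq y z; first by [].
    rewrite val_geP ?mulf_neq0 ?subr_eq0 // pvalM ?subr_eq0 // vx => h.
    have Oyz : O (y - z) by apply: OB; exact: Os.
    have -> // : y = z; apply: Ps => //; apply/pval_gt0 => //; rewrite ?subr_eq0 //.
    by move: h; rewrite -addn1 PoszD lerD2l => /(lt_le_trans _); apply.
move=> z [Oz Iz].
have /val_ge0_locring [b [c [Ob Oc nPc Ezx]]] : val_ge P 0 (z / x).
  have [->|z0] := eqVneq z 0; first by rewrite mul0r; exact: (val_ge_subgroup hP 0).1.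
  apply/val_geP; rewrite ?mulf_neq0 ?invr_eq0 //.
  have : (count_mem P ps)%:Z <= pval P z by apply/val_geP => //; exact: Iz.
  have zx0 : z / x != 0 by rewrite mulf_neq0 ?invr_eq0.
  by rewrite -{1}[z](divfK x0) (pvalM hP zx0 x0) vx lerDr.
have [t Ot Pt] := prime_inverse hP Oc nPc.
have [r rs Pr] := cov _ (OM Ot Ob); have Or := Os r rs.
have c0 : c != 0 by apply/eqP => c0; apply: nPc; rewrite c0; exact: prime0.
exists (x * r); first exact: map_f.
have [Oxr Ixr] := Ixy r Or; split=> [|Q hQ]; first exact: OB.
have [->|QP] := eqVneq Q P; last first.
  rewrite /= eq_sym (negPf QP); apply: (val_ge_subgroup hQ _).2; [exact: Iz | exact: Ixr].
rewrite cP -addn1 PoszD.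
have -> : z - x * r = x * (b / c * (1 - t * c) + (t * b - r)).
  rewrite (_ : b / c * (1 - t * c) = b / c - t * b); last by field.
  by rewrite -Ezx; field.
apply: val_geM => //; first by apply/val_geP; rewrite ?vx.
have g1 y : P y -> val_ge P 1 y by move=> Py; apply: (prime_val_ge1 hP (prime_sub hP Py)).1.
apply: (subgroupD (val_ge_subgroup hP 1)); last exact: g1.
rewrite -[1]add0r; apply: val_geM => //; last exact: g1.
by apply/val_ge0_locring; exists b, c.
Qed.

Lemma multideal_index ps : (forall Q, Q \in ps -> is_prime Q) ->
  has_index O (multideal ps) (\prod_(P <- ps) prime_norm P).
Proof.
elim: ps => [|P ps IH] hps.
  rewrite big_nil; exists [:: 0]; split=> //.
    split=> // [x|x y]; first by rewrite inE => /eqP ->; exact: O0.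
    by rewrite !inE => /eqP -> /eqP ->.
  by move=> x Ox; exists 0; rewrite ?inE // subr0; exact: multideal_O.
rewrite big_cons mulnC.
have hps' Q : Q \in ps -> is_prime Q by move=> Qs; apply: hps; rewrite inE Qs orbT.
have hP : is_prime P by apply: hps; rewrite inE eqxx.
apply: (has_index_mul (O_subgroup F) (multideal_subgroup ps) (multideal_subgroup _) _ _ (IH hps')).
- by move=> x [].
- move=> x [Ox Ix]; split=> // Q hQ; apply: val_ge_le (Ix Q hQ) => //=; lia.
- exact: multideal_step.
Qed.

Lemma integral_power_quotient (a : F) n b : a != 0 -> (0 < n)%N ->
  (forall P, is_prime P -> b != 0 -> (n.-1)%:Z * pval P a <= n%:Z * pval P b) ->
  O (b ^+ n / a ^+ n.-1).
Proof.
move=> a0 n0 h; apply: O_global => P hP.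
have [->|b0] := eqVneq b 0.
  by rewrite expr0n gtn_eqF // mul0r; exact: (val_ge_subgroup hP 0).1.
have X0 : b ^+ n / a ^+ n.-1 != 0 by rewrite mulf_neq0 ?invr_eq0 ?expf_neq0.
apply/val_geP => //.
have := h P hP b0; rewrite -!pvalX //.
by rewrite -{1}[b ^+ n](divfK (expf_neq0 n.-1 a0)) (pvalM hP X0 (expf_neq0 _ a0)) lerDr.
Qed.

End IdealIndex.

(** * Classes modulo n-th powers *)

Section MultiList.
Variable T : eqType.
Implicit Types (m : T -> nat) (us : seq T).
Definition mlist m us := flatten [seq nseq (m x) x | x <- us].

Lemma count_mlist m us x : uniq us ->
  count_mem x (mlist m us) = if x \in us then m x else 0%N.
Proof.
elim: us => //= y us IH /andP [yus uus]; rewrite count_cat count_nseq IH // inE /= [y == x]eq_sym.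
have [->|_] := eqVneq x y; first by rewrite (negPf yus) mul1n addn0.
by rewrite mul0n.
Qed.

Lemma mem_mlist m us x : x \in mlist m us -> x \in us.
Proof.
by move=> /flattenP [_ /mapP [y yus ->]]; rewrite mem_nseq => /andP [_ /eqP ->].
Qed.

Lemma prod_mlist m us (f : T -> nat) :
  \prod_(x <- mlist m us) f x = (\prod_(x <- us) f x ^ m x)%N.
Proof.
elim: us => [|x us IH]; first by rewrite !big_nil.
by rewrite /mlist /= big_cat big_cons -/(mlist m us) IH big_nseq -Monoid.iteropE -expnE.
Qed.
End MultiList.

Section Kummer.
Variable F : fieldExtType rat.
Local Notation O := (ring_of_integers F).

(** The ideal generated by a is the product of the primes P to the powers
    given by the valuations of a. *)
Lemma principal_index a us : O a -> a != 0 -> uniq us ->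
  (forall P : set F, P \in us -> is_prime P) ->
  (forall P : set F, is_prime P -> P a -> P \in us) ->
  has_index O (principal a) (\prod_(P <- us) prime_norm P ^ `|pval P a|).
Proof.
move=> Oa a0 uus us_prime us_all.
rewrite -(prod_mlist (fun P => `|pval P a|%N) us (@prime_norm F)); set ps := mlist _ us.
have hps (Q : set F) : Q \in ps -> is_prime Q by move=> /mem_mlist /us_prime.
suff -> : principal a = multideal ps by exact: multideal_index.
have cP (P : set F) : is_prime P -> (count_mem P ps)%:Z = pval P a.
  move=> hP; rewrite count_mlist //; have v0 := pval_ge0 hP Oa a0.
  case: ifP => [_|nP]; first by rewrite gez0_abs.
  apply/esym/eqP; rewrite eq_le v0 andbT leNgt; apply/negP => /(pval_gt0 hP Oa a0) Pa.
  by rewrite us_all in nP.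
apply/seteqP; split=> x /=.
  move=> [y Oy <-]; split=> [|P hP]; first exact: OM.
  rewrite cP // -[pval P a]addr0; apply: val_geM => //; last exact: val_ge_O.
  exact/val_geP.
move=> [Ox Ix]; exists (x / a); last by field.
apply: O_global => P hP.
have [->|x0] := eqVneq x 0; first by rewrite mul0r; exact: (val_ge_subgroup hP 0).1.
have xa0 : x / a != 0 by rewrite mulf_neq0 ?invr_eq0.
have := Ix P hP; rewrite cP // => /(val_geP hP _ x0); rewrite -{1}[x](divfK a0) (pvalM hP xa0 a0).
by rewrite lerDr => /(val_geP hP _ xa0).
Qed.

Lemma dg_gt0 (fr : frame F) : (0 < dg fr)%N.
Proof.
have := emb_norm_eq0 fr 0; rewrite eqxx /emb_norm; case: posnP => // d0 /eqP.
rewrite big1; first by move/eqP; rewrite oner_eq0.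
by move=> [i hi] _; exfalso; move: hi; rewrite d0.
Qed.

Lemma expn_prod (I : Type) (r : seq I) (G : I -> nat) n :
  ((\prod_(i <- r) G i) ^ n = \prod_(i <- r) G i ^ n)%N.
Proof. exact: (big_morph (fun x => x ^ n)%N (fun x y => expnMn x y n) (exp1n n)). Qed.

Lemma emb_cj_norm (fr : frame F) i a : `|emb (cj i) a| = `|emb (f := fr) i a|.
Proof. by rewrite emb_cj norm_conjC. Qed.

(** Each class of a modulo n-th powers contains b^n / a^(n-1) for b <> 0. The
    proof finds b for which this is integral with bounded conjugates. The
    bound does not depend on a because the ideal of the b to be considered
    has index at most a constant times the norm of a to the power (n-1)/n. *)
Lemma selmer_finite n (T : set (set F)) : (0 < n)%N -> finite_set T ->
  exists A : seq F, forall a, a != 0 ->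
    (forall P, is_prime P -> ~ T P -> (n%:Z %| pval P a)%Z) ->
    exists2 b, b != 0 & a * b ^+ n \in A.
Proof.
move=> n0 fT; have [fr _] := frame_exists F.
pose T' := T `&` [set P | is_prime P].
have [ts Ets] : exists ts : seq (set F), T' = [set` ts].
  by apply/finite_seqP; apply: sub_finite_set fT => P [].
have [C HC] := index_principal_le fr.
have [ka ka0 Hka] := minkowski fr.
(* at the primes of T the exponents below are rounded up, which costs CT *)
pose CT := (\prod_(P <- undup ts) prime_norm P)%N.
(* L > 0 makes the volume hypothesis of the pigeonhole argument hold for every a *)
pose L := (Num.truncn (ka ^+ n * CT%:R ^+ n * C%:R ^+ n.-1)).+1.
have LE : ka ^+ n * CT%:R ^+ n * C%:R ^+ n.-1 < L%:R.
  have h : 0 <= ka ^+ n * CT%:R ^+ n * C%:R ^+ n.-1.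
    by rewrite !mulr_ge0 ?exprn_ge0 ?ler0n // ltW.
  by case/andP: (truncn_itv h).
have [A HA] := bounded_finite fr ((2 * L) ^ n)%N.
exists A.
(* a may be multiplied by the n-th power of an integer *)
suff main a : O a -> a != 0 -> (forall P, is_prime P -> ~ T P -> (n%:Z %| pval P a)%Z) ->
    exists2 b, b != 0 & a * b ^+ n \in A.
  move=> a a0 Ha; have [m m0 Oma] := integral_multiple a.
  have m0F : m%:~R != 0 :> F by rewrite intrF_eq0.
  have mn0 : m%:~R ^+ n != 0 :> F by rewrite expf_neq0.
  have [|||b b0 Hb] := main (m%:~R ^+ n * a).
  - rewrite -(prednK n0) exprSr -mulrA; apply: OM => //; apply: OX; exact: Oint.
  - exact: mulf_neq0.
  - move=> P hP nTP; rewrite pvalM // pvalX //; apply: rpredD; last exact: Ha.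
    by rewrite dvdz_mulr.
  exists (m%:~R * b); first exact: mulf_neq0.
  by rewrite exprMn mulrCA mulrA.
move=> Oa a0 Ha.
have [us0 Eus0] : exists us : seq (set F), [set P | is_prime P /\ P a] = [set` us].
  by apply/finite_seqP; exact: finite_primes_above.
pose us := undup (us0 ++ ts).
have us_prime (P : set F) : P \in us -> is_prime P.
  rewrite mem_undup mem_cat => /orP [h|h].
    have : [set` us0] P by [].
    by rewrite -Eus0 => -[].
  have : [set` ts] P by [].
  by rewrite -Ets => -[].
have us_all P : is_prime P -> P a -> P \in us.
  move=> hP Pa; rewrite mem_undup mem_cat; apply/orP; left.
  have : [set P | is_prime P /\ P a] P by [].
  by rewrite Eus0.
have us_T P : is_prime P -> T P -> P \in ts.
  move=> hP TP; have : T' P by [].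
  by rewrite Ets.
pose e P := `|pval P a|%N.
(* an integer at least (n-1)/n times the valuation of a, with equality outside T *)
pose w P := ((n.-1 * e P) %/ n + (P \in ts))%N.
have vE P : is_prime P -> pval P a = (e P)%:Z.
  by move=> hP; rewrite gez0_abs //; exact: pval_ge0.
have w_ge P : is_prime P -> (n.-1 * e P <= n * w P)%N.
  move=> hP; rewrite /w mulnDr.
  have [TP|nTP] := pselect (T P).
    rewrite us_T // muln1; apply: ltnW.
    by rewrite {1}(divn_eq (n.-1 * e P) n) mulnC ltn_add2l ltn_mod.
  have /dvdzP [q Eq] := Ha P hP nTP.
  have /dvdnP [q' Eq'] : (n %| e P)%N by rewrite /e Eq abszM dvdn_mull.
  by rewrite Eq' mulnA mulnK // mulnC leq_addr.
have w_le P : (n * w P <= n.-1 * e P + n * (P \in ts))%N.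
  by rewrite /w mulnDr leq_add2r mulnC leq_trunc_div.
pose ps := mlist w us.
have hps (Q : set F) : Q \in ps -> is_prime Q by move=> /mem_mlist /us_prime.
pose N := (\prod_(P <- ps) prime_norm P)%N.
have hN : has_index O (multideal ps) N by exact: multideal_index.
pose Na := (\prod_(P <- us) prime_norm P ^ e P)%N.
have Na_le : Na%:R <= C%:R * `|emb_norm fr a|.
  have [s [sE inc _]] := principal_index Oa a0 (undup_uniq _) us_prime us_all.
  by have := HC a Oa a0 s inc; rewrite sE.
have N_le : (N ^ n <= CT ^ n * Na ^ n.-1)%N.
  have -> : CT = (\prod_(P <- us) prime_norm P ^ (P \in ts))%N.
    rewrite (eq_bigr (fun P => if P \in ts then prime_norm P else 1%N)); last first.
      by move=> P _; case: ifP => _; rewrite ?expn1 ?expn0.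
    rewrite -big_mkcond -big_filter; apply: perm_big; apply: uniq_perm.
    - exact: undup_uniq.
    - by rewrite filter_uniq ?undup_uniq.
    - by move=> P; rewrite mem_filter !mem_undup mem_cat; case: (P \in ts); rewrite ?orbT.
  rewrite /N prod_mlist /Na !expn_prod -big_split /=.
  rewrite [leqLHS]big_seq [leqRHS]big_seq; apply: leq_prod => P Pus.
  rewrite -!expnM -expnD leq_pexp2l ?prime_norm_gt0 //; first exact: us_prime.
  by rewrite mulnC (leq_trans (w_le P)) // addnC leq_add // mulnC.
have nr n' : 0 <= `|emb_norm fr a| ^+ n' by rewrite exprn_ge0.
have N_lt : (N%:R * ka) ^+ n < L%:R ^+ n * `|emb_norm fr a| ^+ n.-1.
  rewrite exprMn -[N%:R ^+ n]natrX; apply: (@le_lt_trans _ _ ((CT ^ n * Na ^ n.-1)%:R * ka ^+ n)).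
    by apply: ler_wpM2r; [rewrite exprn_ge0 // ltW | rewrite ler_nat].
  rewrite natrM !natrX.
  apply: (@le_lt_trans _ _ (CT%:R ^+ n * (C%:R * `|emb_norm fr a|) ^+ n.-1 * ka ^+ n)).
    rewrite ler_wpM2r ?exprn_ge0 ?(ltW ka0) // ler_wpM2l ?exprn_ge0 //.
    by rewrite lerXn2r ?nnegrE ?mulr_ge0.
  rewrite exprMn.
  have -> : CT%:R ^+ n * (C%:R ^+ n.-1 * `|emb_norm fr a| ^+ n.-1) * ka ^+ n =
    (ka ^+ n * CT%:R ^+ n * C%:R ^+ n.-1) * `|emb_norm fr a| ^+ n.-1 by ring.
  rewrite ltr_pM2r; last by rewrite exprn_gt0 // normr_gt0 emb_norm_eq0.
  apply: (lt_le_trans LE); rewrite -natrX ler_nat -{1}[L]expn1.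
  by rewrite leq_pexp2l.
pose c i := L%:R * n.-root `|emb (f := fr) i a| ^+ n.-1.
have r0 i : 0 < n.-root `|emb (f := fr) i a|.
  by rewrite rootC_gt0 // normr_gt0 fmorph_eq0.
have c0 i : 0 < c i by rewrite mulr_gt0 ?ltr0n // exprn_gt0.
have cX i : c i ^+ n = L%:R ^+ n * `|emb (f := fr) i a| ^+ n.-1.
  by rewrite exprMn exprAC rootCK.
have cc i : c (cj i) = c i by rewrite /c emb_cj_norm.
have volume : N%:R * ka < \prod_i c i.
  have p0 : 0 <= N%:R * ka by rewrite mulr_ge0 // ltW.
  have q0 : 0 <= \prod_i c i by apply: prodr_ge0 => i _; exact: ltW.
  rewrite -(ltr_pXn2r n0) ?nnegrE //; apply: (lt_le_trans N_lt).
  rewrite -prodrXl (eq_bigr _ (fun i _ => cX i)) big_split /=.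
  have -> : \prod_i `|emb (f := fr) i a| ^+ n.-1 = `|emb_norm fr a| ^+ n.-1.
    by rewrite prodrXl -normr_prod.
  rewrite ler_wpM2r // prodr_const card_ord.
  by rewrite ler_eXnr ?dg_gt0 // exprn_ege1 // ler1n.
have [s [sN inc cov]] := hN.
have N0 : (0 < N)%N by apply: has_index_gt0 hN _; exact: O0.
have [x [y [Ox Oy Exy xy bd]]] : exists x y, [/\ O x, O y, multideal ps (x - y), x <> y &
    forall i, `|emb (f := fr) i (x - y)| <= 2 * c i].
  have repr x : exists k : 'I_N, O x -> multideal ps (x - s`_k).
    have [Ox|nOx] := pselect (O x); last by exists (Ordinal N0).
    have [r rs Ir] := cov x Ox.
    have lt : (index r s < N)%N by rewrite -sN index_mem.
    by exists (Ordinal lt) => _; rewrite nth_index.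
  have [cls Hcls] := choice repr.
  have [x [y [Ox Oy Exy xy bd]]] := Hka N cls c c0 cc volume.
  exists x, y; split=> //.
  have -> : x - y = (x - s`_(cls x)) - (y - s`_(cls y)) by rewrite Exy; ring.
  by apply: (multideal_subgroup ps).2; exact: Hcls.
pose b := x - y.
have b0 : b != 0 by rewrite subr_eq0; apply/eqP.
have Oz : O (b ^+ n / a ^+ n.-1).
  apply: integral_power_quotient => // P hP _.
  have [_ /(_ P hP) /(val_geP hP _ b0)] := Exy.
  rewrite vE // count_mlist ?undup_uniq // => h.
  apply: (@le_trans _ _ (n%:Z * (w P)%:Z)); first by rewrite -!PoszM lez_nat w_ge.
  rewrite ler_pM2l ?ltz_nat //; apply: le_trans h; case: ifP => // /negP nP.
  rewrite lez_nat leqn0 /w addn_eq0; apply/andP; split.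
    rewrite (_ : e P = 0%N) ?muln0 ?div0n //; apply/eqP; rewrite -leqn0 leqNgt.
    by apply/negP; rewrite -ltz_nat -vE // => /(pval_gt0 hP Oa a0) /(us_all P hP).
  by case Pts: (P \in ts) => //; case: nP; rewrite mem_undup mem_cat Pts orbT.
exists (b / a); first by rewrite mulf_neq0 ?invr_eq0.
have -> : a * (b / a) ^+ n = b ^+ n / a ^+ n.-1.
  rewrite -{1}(prednK n0) exprMn exprVn -(prednK n0) [a ^+ _.+1]exprS.
  by field; rewrite a0 expf_neq0.
apply: HA => // i; rewrite fmorph_div !rmorphXn normrM normfV !normrX.
rewrite ler_pdivrMr ?exprn_gt0 ?normr_gt0 ?fmorph_eq0 //.
rewrite natrX natrM exprMn -mulrA -cX -exprMn lerXn2r ?nnegrE ?bd //.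
by apply: mulr_ge0 => //; exact: ltW.
Qed.
End Kummer.

(** * Number fields inside an algebraically closed field *)

Section Omega.
Variable Om : closedFieldType.

Lemma finite_roots (p : {poly Om}) : p != 0 -> finite_set [set x | root p x].
Proof.
move=> p0; have [r Dr] := closed_field_poly_normal p.
apply: (@sub_finite_set _ _ [set` r]); last exact: finite_seq.
by move=> x /=; rewrite Dr rootZ ?lead_coef_eq0 // root_prod_XsubC.
Qed.

Lemma finite_nth_roots (A : seq Om) n : (0 < n)%N ->
  finite_set [set x : Om | x ^+ n \in A].
Proof.
move=> n0; elim: A => [|a A IH]; first by apply: (@sub_finite_set _ _ set0).
apply: (@sub_finite_set _ _ ([set x | root ('X^n - a%:P) x] `|` [set x | x ^+ n \in A])).
  move=> x /=; rewrite inE => /orP [/eqP xa|]; last by right.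
  by left; rewrite rootE !hornerE xa subrr.
rewrite finite_setU; split=> //; apply: finite_roots.
by rewrite monic_neq0 // monicXnsubC.
Qed.

Lemma range_sub_morphism (F1 F2 : fieldType)
    (g1 : {rmorphism F1 -> Om}) (g2 : {rmorphism F2 -> Om}) :
  (forall x, exists y, g2 y = g1 x) -> exists h : {rmorphism F1 -> F2}, forall x, g2 (h x) = g1 x.
Proof.
move=> /choice [h Eh].
have h_add : zmod_morphism h by move=> x y; apply: (fmorph_inj g2); rewrite Eh !rmorphB /= !Eh.
have h_mul : monoid_morphism h.
  by split=> [|x y]; apply: (fmorph_inj g2); rewrite Eh ?rmorph1 // !rmorphM /= !Eh.
pose h1 := GRing.isZmodMorphism.Build _ _ h h_add.
pose h2 := GRing.isMonoidMorphism.Build _ _ h h_mul.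
pose h3 : {rmorphism _ -> _} := HB.pack h h1 h2.
by exists h3.
Qed.

Variable j : {rmorphism rat -> Om}.
Local Notation ev p z := (map_poly j p).[z].

(** As z is a combination of the elements of xs with integer coefficients, it
    lies in every field that contains them. *)
Lemma primitive_element_seq (xs : seq Om) : (forall x, x \in xs -> algebraicOver j x) ->
  exists z, [/\ algebraicOver j z, forall x, x \in xs -> exists p : {poly rat}, x = ev p z &
    forall (F2 : fieldType) (g2 : {rmorphism F2 -> Om}),
      (forall x, x \in xs -> exists y, g2 y = x) -> exists y, g2 y = z].
Proof.
elim: xs => [|x xs IH] alg.
  exists 0; split=> //; first exact: algebraic0.
  by move=> F2 g2 _; exists 0; rewrite rmorph0.
have [|z [az pz gz]] := IH; first by move=> y ys; apply: alg; rewrite inE ys orbT.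
have ax : algebraicOver j x by apply: alg; rewrite inE eqxx.
have [p p0 px] := ax; have [q q0 qz] := az.
have [n [[r1 Dr1] [r2 Dr2]]] := pchar0_PET p0 px q0 qz (pchar_num _).
pose w := z *+ n - x.
exists w; split.
- apply: algebraic_sub => //; rewrite -mulr_natr; apply: algebraic_mul => //.
  by rewrite -(rmorph_nat j); exact: algebraic_id.
- move=> y; rewrite inE => /predU1P [->|ys]; first by exists r1.
  have [s ->] := pz y ys; exists (s \Po r2).
  by rewrite map_comp_poly horner_comp Dr2.
- move=> F2 g2 h; have [y Ey] := h x (mem_head _ _).
  have [|v Ev] := gz F2 g2; first by move=> u us; apply: h; rewrite inE us orbT.
  by exists (v *+ n - y); rewrite rmorphB rmorphMn /= Ey Ev.
Qed.

Lemma simple_number_field (z : Om) : algebraicOver j z ->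
  exists (F : fieldExtType rat) (g : {rmorphism F -> Om}),
    (exists y, g y = z) /\ forall y, exists p : {poly rat}, g y = ev p z.
Proof.
move=> [p0 p0_neq0 rp0].
pose P n := `[< exists p : {poly rat}, [/\ p != 0, root (map_poly j p) z & size p = n] >].
have exP : exists n, P n by exists (size p0); apply/asboolP; exists p0.
case: (ex_minnP exP) => n /asboolP [p [p_neq0 rp Ep]] minp.
have irr : irreducible_poly p.
  apply/(subfx_irreducibleP rp p_neq0) => q rq q0; rewrite Ep; apply: minp.
  by apply/asboolP; exists q.
exists (SubFieldExtType rp irr), (@subfx_inj _ _ j z p); split.
  by exists (subfx_root j z p); exact: subfx_inj_root.
move=> y; have [q ->] := subfxEroot rp p_neq0 y; exists q.
have Er : @subfx_inj _ _ j z p (subfx_root j z p) = z by exact: subfx_inj_root.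
rewrite -horner_map /= Er -map_poly_comp; congr _.[_].
by apply: eq_map_poly => a; rewrite /= subfx_inj_base.
Qed.

(** The last clause says that the range of g is the smallest subfield
    containing xs; with [range_sub_morphism], it provides morphisms from F. *)
Lemma generated_number_field (xs : seq Om) : (forall x, x \in xs -> algebraicOver j x) ->
  exists (F : fieldExtType rat) (g : {rmorphism F -> Om}),
    [/\ forall x, x \in xs -> exists y, g y = x,
        exists z, algebraicOver j z /\ forall y, exists p : {poly rat}, g y = ev p z &
    forall (F2 : fieldType) (g2 : {rmorphism F2 -> Om}),
      (forall x, x \in xs -> exists y, g2 y = x) -> forall y, exists y2, g2 y2 = g y].
Proof.
move=> /primitive_element_seq [z [az pz gz]].
have [F [g [[y Ey] Hg]]] := simple_number_field az.
have jE (F2 : fieldType) (g2 : {rmorphism F2 -> Om}) (p : {poly rat}) v :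
    exists u, g2 u = ev p (g2 v).
  exists (\sum_(i < size p) ratr p`_i * v ^+ i).
  rewrite rmorph_sum horner_coef (size_map_poly j); apply: eq_bigr => i _.
  by rewrite coef_map rmorphM rmorphXn /= fmorph_rat fmorph_eq_rat.
exists F, g; split.
- by move=> x /pz [p ->]; rewrite -Ey; exact: jE.
- by exists z.
- move=> F2 g2 /gz [v Ev] u; have [p ->] := Hg u; rewrite -Ev; exact: jE.
Qed.

(** Let G be the minimal polynomial of z over a subfield E. It divides a fixed
    polynomial, which leaves finitely many possibilities. And G determines E:
    if an element x = h(z) lies in E, then h - x vanishes at z, so that the
    remainder of h modulo G is the constant x; conversely this remainder has
    its coefficients in E. *)
Lemma finite_subfields (z : Om) : algebraicOver j z ->
  finite_set [set E : set Om | 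
    exists (L : fieldType) (k : {rmorphism rat -> L}) (f : {rmorphism L -> Om}),
    E = range f /\ forall y, exists p : {poly rat}, f y = ev p z].
Proof.
move=> [m m0 rm]; have [rs Drs] := closed_field_poly_normal (map_poly j m).
pose G (b : (size rs).-tuple bool) := \prod_(r <- mask b rs) ('X - r%:P).
(* the field that is determined by a divisor G b of the fixed polynomial *)
pose Phi b : set Om := [set x | exists h : {poly rat}, (map_poly j h) %% G b = x%:P].
apply: (@sub_finite_set _ _ (Phi @` setT)); last exact/finite_image/finite_finset.
move=> E /= [L [k [f [-> gen]]]].
have fk p : map_poly f (map_poly k p) = map_poly j p.
  rewrite -map_poly_comp; apply: eq_map_poly => a /=.
  by rewrite !fmorph_eq_rat fmorph_rat.
pose Q n := `[< exists p : {poly L}, [/\ p \is monic, root (map_poly f p) z & size p = n] >].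
have exQ : exists n, Q n.
  exists (size m); apply/asboolP; exists ((lead_coef (map_poly k m))^-1 *: map_poly k m).
  have l0 : lead_coef (map_poly k m) != 0 by rewrite lead_coef_eq0 map_poly_eq0.
  split; first by rewrite monicE lead_coefZ mulVf.
    by rewrite map_polyZ fk rootZ // fmorph_eq0 invr_eq0.
  by rewrite size_scale ?invr_eq0 // size_map_poly.
case: (ex_minnP exQ) => n /asboolP [g [mg rg En]] ming.
have div_g (q : {poly L}) : root (map_poly f q) z -> g %| q.
  move=> rq; rewrite /dvdp; apply: contraT => r0.
  have : root (map_poly f (q %% g)) z.
    move: rq; rewrite {1}(divp_eq q g) rmorphD rmorphM /root hornerD hornerM (rootP rg).
    by rewrite mulr0 add0r.
  set r := q %% g in r0 * => rr.
  have : Q (size r).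
    apply/asboolP; exists ((lead_coef r)^-1 *: r).
    have l0 : lead_coef r != 0 by rewrite lead_coef_eq0.
    split; first by rewrite monicE lead_coefZ mulVf.
      by rewrite map_polyZ rootZ // fmorph_eq0 invr_eq0.
    by rewrite size_scale ?invr_eq0.
  by move=> /ming; rewrite -En leqNgt ltn_modp monic_neq0.
have sg : (1 < size g)%N.
  by rewrite -(size_map_poly f) (root_size_gt1 _ rg) // map_poly_eq0 monic_neq0.
have : map_poly f g %| \prod_(r <- rs) ('X - r%:P).
  have : map_poly f g %| map_poly j m by rewrite -fk dvdp_map div_g // fk.
  by rewrite Drs dvdpZr // lead_coef_eq0 map_poly_eq0.
move=> /dvdp_prod_XsubC [b].
rewrite eqp_monic ?monic_prod_XsubC ?map_monic // => /eqP Eg.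
have [b' Eb'] : exists b' : (size rs).-tuple bool, map_poly f g = G b'.
  have [b' sb' Eb'] := resize_mask b rs; have tb' : size b' == size rs by apply/eqP.
  by exists (Tuple tb'); rewrite Eg Eb'.
exists b' => //; rewrite /Phi -Eb'; apply/seteqP; split=> x /=.
  move=> [h]; rewrite -fk -map_modp => E'.
  exists ((map_poly k h %% g)`_0) => //.
  by rewrite -coef_map E' coefC eqxx.
move=> [y _ <-]; have [h Eh] := gen y; exists h.
have : g %| map_poly k h - y%:P.
  by apply: div_g; rewrite /root rmorphB /= fk map_polyC hornerD hornerN hornerC -Eh subrr.
rewrite -fk -map_modp -map_polyC; move=> dv; congr map_poly.
have -> : map_poly k h = (map_poly k h - y%:P) + y%:P by rewrite subrK.
rewrite modpD (modp_eq0 dv) add0r modp_small // (leq_ltn_trans _ sg) //.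
exact: size_polyC_leq1.
Qed.
End Omega.

(** * Ramification *)

Section ZeroSum.
Variables (F : fieldExtType rat) (P : set F) (hP : is_prime P).

(** The other two terms, hence also x, would have a larger valuation than x. *)
Lemma dominant_term x y z : x != 0 -> x + (y + z) = 0 ->
  (y != 0 -> pval P x < pval P y) -> (z != 0 -> pval P x < pval P z) -> False.
Proof.
move=> x0 E hy hz.
have g t : (t != 0 -> pval P x < pval P t) -> val_ge P (pval P x + 1) t.
  have [-> _|t0 /(_ isT) h] := eqVneq t 0; first exact: (val_ge_subgroup hP _).1.
  by apply/val_geP => //; rewrite lezD1.
have : val_ge P (pval P x + 1) x.
  have Ex : x = - (y + z) by apply/eqP; rewrite -addr_eq0 E.
  rewrite [X in val_ge _ _ X]Ex.
  apply: (subgroupN (val_ge_subgroup hP _)).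
  exact: (subgroupD (val_ge_subgroup hP _) (g y hy) (g z hz)).
by move=> /(val_geP hP _ x0); rewrite lezD1 ltxx.
Qed.

(** In a vanishing sum, the minimal valuation is attained at least twice. *)
Lemma no_zero_sum x y z : x != 0 -> x + (y + z) = 0 ->
  (y != 0 -> pval P x <> pval P y) -> (z != 0 -> pval P x <> pval P z) ->
  (y != 0 -> z != 0 -> pval P y <> pval P z) -> False.
Proof.
move=> x0 E hy hz hyz.
have E1 : y + (x + z) = 0 by rewrite addrCA.
have E2 : z + (x + y) = 0 by rewrite addrC -addrA.
have [y0|y0] := eqVneq y 0; have [z0|z0] := eqVneq z 0.
- by move: E x0; rewrite y0 z0 !addr0 => ->; rewrite eqxx.
- have := hz z0; case: (ltgtP (pval P x) (pval P z)) => // [lt|gt] _.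
    by apply: (dominant_term x0 E) => //; rewrite y0 eqxx.
  by apply: (dominant_term z0 E2) => //; rewrite y0 eqxx.
- have := hy y0; case: (ltgtP (pval P x) (pval P y)) => // [lt|gt] _.
    by apply: (dominant_term x0 E) => //; rewrite z0 eqxx.
  by apply: (dominant_term y0 E1) => //; rewrite z0 eqxx.
have := hy y0; have := hz z0; have := hyz y0 z0 => n1 n2 n3.
case: (ltgtP (pval P x) (pval P y)) => // lt1; case: (ltgtP (pval P x) (pval P z)) => // lt2.
- exact: (dominant_term x0 E).
- by apply: (dominant_term z0 E2) => // _; exact: lt_trans lt1.
- by apply: (dominant_term y0 E1) => // _; exact: lt_trans lt2.
- case: (ltgtP (pval P y) (pval P z)) => // lt3.
    by apply: (dominant_term y0 E1).
  by apply: (dominant_term z0 E2).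
Qed.
End ZeroSum.

Section Extensions.
Variables (F1 F2 : fieldExtType rat) (f : {rmorphism F1 -> F2}).

(** Take a prime that contains the x for which gamma x is integral, with gamma
    attached to p. This ideal is proper since gamma is not integral, and it
    contains p since gamma p is contained in the ring of integers. *)
Lemma lying_over p : is_prime p -> exists2 P : set F2, is_prime P & f @^-1` P = p.
Proof.
move=> hp; have [ng gp] := gammaP hp.
pose J : set F2 := [set x | ring_of_integers F2 x /\ ring_of_integers F2 (f (gamma p) * x)].
have hJ : is_ideal J.
  split.
  - by move=> x [].
  - by split; rewrite ?mulr0; exact: O0.
  - by move=> x y [Ox Ogx] [Oy Ogy]; split; rewrite ?mulrDr; exact: OD.
  - by move=> b x Ob [Ox Ogx]; split; rewrite ?[_ * (b * x)]mulrCA; exact: OM.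
have pJ x : p x -> J (f x).
  move=> px; split; first exact: ((O_morph f x).1 (prime_sub hp px)).
  by rewrite -rmorphM; apply: (O_morph f _).1; exact: gp.
have nJ1 : ~ J 1 by move=> [_]; rewrite mulr1 => /(O_morph f _).2.
have [a pa a0] := prime_nonzero hp.
have fa0 : f a != 0 by rewrite fmorph_eq0.
have [P hP JP] := maximal_above hJ (pJ a pa) fa0 nJ1.
exists P => //; apply: contrapT => ne.
have hP1 := prime_preimage f hP.
have [t pt nPt] := prime_distinct hp hP1 (fun E => ne (esym E)).
by apply: nPt; apply: JP; exact: pJ.
Qed.

(** A uniformizer pi at P satisfies pi^2 + b pi + c = 0 with b and c in F1. The
    three terms have valuations 2, congruent to 1 and congruent to 0 modulo
    the ramification index e, so they would be distinct for e > 2. *)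
Lemma ramification_quadratic (z : F2) P : is_prime P ->
  z ^+ 2 = - z - 1 -> (forall y, exists u v, y = f u + f v * z) ->
  exists e : int, [/\ 0 < e, e <= 2 & forall x, x != 0 -> pval P (f x) = e * pval (f @^-1` P) x].
Proof.
move=> hP Ez gen; have [e e0 He] := pval_morph f hP.
exists e; split=> //; rewrite leNgt; apply/negP => e2.
have [pi [_ pi0 vpi]] := pval_uniformizer hP; have [u [v Epi]] := gen pi.
(* pi is a root of X^2 + b X + c *)
pose b := v - u *+ 2; pose c := u ^+ 2 - u * v + v ^+ 2.
have E : pi ^+ 2 + (f b * pi + f c) = 0.
  rewrite /b /c !(rmorphD, rmorphB, rmorphMn, rmorphXn, rmorphM) /= Epi.
  transitivity (f v ^+ 2 * (z ^+ 2 + z + 1)); first by ring.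
  by rewrite Ez; ring.
have pi2 : pval P (pi ^+ 2) = 2 by rewrite pvalX // vpi.
have p20 : pi ^+ 2 != 0 by rewrite expf_neq0.
have ek k : e * k <> 1 /\ e * k <> 2.
  have [k1|k0] := lerP 1 k.
    have : e * 1 <= e * k by rewrite ler_pM2l.
    by rewrite mulr1; lia.
  have : e * k <= e * 0 by rewrite ler_pM2l //; lia.
  by rewrite mulr0; lia.
apply: (no_zero_sum hP p20 E); rewrite ?mulf_eq0 ?negb_or ?fmorph_eq0.
- move=> /andP [b0 _]; rewrite pi2 pvalM ?fmorph_eq0 // He // vpi.
  by have [h _] := ek (pval (f @^-1` P) b); move=> h'; apply: h; lia.
- by move=> c0; rewrite pi2 He // => h'; have [_ h] := ek (pval (f @^-1` P) c); apply: h.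
- move=> /andP [b0 _] c0; rewrite pvalM ?fmorph_eq0 // !He // vpi => h'.
  have [h _] := ek (pval (f @^-1` P) c - pval (f @^-1` P) b); apply: h.
  by rewrite mulrBr -h'; ring.
Qed.
End Extensions.

Section Unramified.
Variables (K : fieldExtType rat) (L : fieldExtType K).
Local Notation Lq := (baseFieldType L : fieldExtType rat).

(** The inclusion of K in L as a morphism between extensions of rat. *)
Definition base_embedding : {rmorphism K -> Lq} := (in_alg L : {rmorphism K -> L}).

Lemma ideal_span_ideal (F : fieldExtType rat) (A : set F) :
  A `<=` ring_of_integers F -> is_ideal (ideal_span A).
Proof.
move=> AO; split.
- move=> x; apply; split=> //; split.
  + exact: subset_refl.
  + exact: O0.
  + by move=> y z; exact: OD.
  + by move=> b y; exact: OM.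
- by move=> I [[_ I0 _ _] _].
- by move=> x y hx hy I hI; have [[_ _ ID _] _] := hI; apply: ID; [exact: hx | exact: hy].
- by move=> b x Ob hx I hI; have [[_ _ _ IM] _] := hI; apply: IM => //; exact: hx.
Qed.

Lemma square_ideal (F : fieldExtType rat) (P : set F) : is_prime P -> is_ideal (ideal_exp P 2).
Proof.
move=> hP; have PO x : P x -> ring_of_integers F x by exact: prime_sub.
have h1 : is_ideal (ideal_mul P (ring_of_integers F)).
  by apply: ideal_span_ideal => _ [x Px [y Oy <-]]; apply: OM => //; exact: PO.
apply: ideal_span_ideal => _ [x Px [y Py <-]]; apply: OM; first exact: PO.
by case: h1 => IO _ _ _; exact: IO.
Qed.

(** The prime of K below P generates an ideal of L that is contained in P but
    not in the square of P. *)
Lemma unramified_uniformizer (S : set (set K)) (P : set Lq) :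
  unramified_outside L S -> is_prime P -> ~ S (base_embedding @^-1` P) ->
  exists2 pi : K, pi != 0 & pval P (base_embedding pi) = 1.
Proof.
move=> unr hP nS; have hp := prime_preimage base_embedding hP.
have [_ ram] := unr _ hp nS P hP erefl.
apply: contrapT => none; apply: ram => x; apply; split.
  exact: (@square_ideal Lq P hP).
move=> _ [pi ppi <-].
have Ppi : P (base_embedding pi) by exact: ppi.
have [->|pi0] := eqVneq pi 0; first by rewrite rmorph0; case: (square_ideal hP).
have fpi0 : base_embedding pi != 0 by rewrite fmorph_eq0.
have Opi := prime_sub hP Ppi.
apply: (@val_ge2_square Lq P hP (base_embedding pi) Opi); apply/(val_geP hP _ fpi0).
have v0 : 0 < pval P (base_embedding pi) by apply/(pval_gt0 hP Opi fpi0).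
rewrite leNgt; apply/negP => v2; apply: none; exists pi => //; lia.
Qed.
End Unramified.

(** * Galois groups of order 2, 3 and 6 *)

Local Close Scope classical_set_scope.
Section Index2.

Variables (gT : finGroupType) (G H : {group gT}) (t : gT).
Hypotheses (sHG : H \subset G) (iGH : #|G : H|%g = 2%N) (Gt : t \in G) (nHt : t \notin H).

Lemma index2_cover g : g \in G -> g \in H \/ exists2 h, h \in H & g = (h * t)%g.
Proof.
have disj : [disjoint H & (H :* t)%g].
  rewrite -setI_eq0; apply/eqP/setP => x; rewrite !inE; apply/negP => /andP [Hx].
  by rewrite mem_rcoset groupMl // groupV (negPf nHt).
have : (H :|: H :* t)%g == G.
  rewrite eqEcard finset.subUset sHG mul_subG ?finset.sub1set //=.
  by rewrite cardsU disjoint_setI0 // cards0 subn0 card_rcoset -(Lagrange sHG) iGH muln2 addnn.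
move=> /eqP <-; rewrite !inE => /orP [Hg|Htg]; [by left | right].
exists (g * t^-1)%g; last by rewrite mulgKV.
by rewrite -mem_rcoset.
Qed.

Lemma index2_square : (t * t)%g \in H.
Proof.
case: (index2_cover (groupM Gt Gt)) => // -[h Hh /mulIg E].
by have := nHt; rewrite E Hh.
Qed.
End Index2.

Section GaloisData.
Variables (K : fieldType) (L : splittingFieldType K).
Hypothesis galL : galois 1%VS {:L}%VS.
Hypothesis two_neq0 : (2 : L) != 0.
Local Notation G := 'Gal({:L} / 1)%g.

Lemma fixed_in_base (y : L) : (forall g, g \in G -> g y = y) -> exists u : K, y = in_alg L u.
Proof.
move=> fy; have : y \in fixedField G by apply/fixedFieldP; rewrite ?memvf.
by rewrite (galois_fixedField galL) => /vlineP [u ->]; exists u.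
Qed.

(** For t in G outside H, some x fixed by H is not fixed by t, since otherwise
    H and G would have the same fixed field. Take de = x - t x, which is fixed
    by H and negated by t. *)
Lemma quadratic_resolvent (H : {group gal_of {:L}}) : H \subset G -> #|G : H|%g = 2%N ->
  exists (de : L) (a : K), [/\ de != 0, de ^+ 2 = in_alg L a,
    de \in fixedField H &
    forall y, y \in fixedField H -> exists u v : K, y = in_alg L u + in_alg L v * de].
Proof.
move=> sHG iGH.
have [t Gt nHt] : exists2 t, t \in G & t \notin H.
  apply/subsetPn; apply/negP => sGH.
  have E : G = H :> {set _} by apply/eqP; rewrite finset.eqEsubset sGH.
  by move: iGH; rewrite -E indexgg.
have tt := index2_square sHG iGH Gt nHt.
have cover := index2_cover sHG iGH Gt nHt.
have nH : (H <| G)%g by exact: index2_normal.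
have fixH y h : y \in fixedField H -> h \in H -> h y = y.
  by move=> /mem_fixedFieldP [_ fy] /fy.
have tfix y : y \in fixedField H -> t y \in fixedField H.
  move=> Hy; apply/fixedFieldP => [|h Hh]; rewrite ?memvf //.
  have Hh' : (t * h * t^-1)%g \in H.
    have -> : (t * h * t^-1)%g = (h ^ t^-1)%g by rewrite conjgE invgK mulgA.
    by rewrite memJ_norm // groupV (fintype.subsetP (normal_norm nH)).
  by rewrite -galM ?memvf // -[(t * h)%g](mulgKV t) galM ?memvf // (fixH y _ Hy Hh').
have ttK y : y \in fixedField H -> t (t y) = y.
  by move=> Hy; rewrite -galM ?memvf // (fixH y).
have base y : y \in fixedField H -> t y = y -> exists u : K, y = in_alg L u.
  move=> Hy ty; apply: fixed_in_base => g /cover [Hg|[h Hh ->]]; first exact: fixH.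
  by rewrite galM ?memvf // (fixH y).
have [x Hx tx] : exists2 x, x \in fixedField H & t x != x.
  apply: contrapT => none.
  have sub : (fixedField H <= fixedField G)%VS.
    apply/subvP => y Hy; rewrite (galois_fixedField galL).
    have [|u ->] := base y Hy; last by rewrite in_algE memvZ ?mem1v.
    by apply/eqP; apply: contrapT => /negP ty; apply: none; exists y.
  have := galS {:L} sub; rewrite !gal_fixedField => /fintype.subsetP /(_ t Gt).
  by rewrite (negPf nHt).
pose de := x - t x.
have de0 : de != 0 by rewrite subr_eq0 eq_sym.
have Hde : de \in fixedField H by rewrite rpredB // tfix.
have tde : t de = - de by rewrite rmorphB /= ttK // opprB.
have [a Ea] : exists a : K, de ^+ 2 = in_alg L a.
  by apply: base; rewrite ?rpredX // rmorphXn /= tde sqrrN.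
exists de, a; split=> // y Hy.
have [u Eu] : exists u : K, (y + t y) / 2 = in_alg L u.
  apply: base.
    by rewrite rpredM ?rpredD ?tfix // rpredV rpred_nat.
  by rewrite rmorphM rmorphD /= ttK // fmorphV rmorph_nat addrC.
have [v Ev] : exists v : K, (y - t y) / (2 * de) = in_alg L v.
  apply: base.
    by rewrite rpredM ?rpredB ?tfix // rpredV rpredM ?rpred_nat.
  rewrite rmorphM rmorphB /= ttK // fmorphV rmorphM rmorph_nat /= tde.
  by rewrite mulrN invrN mulrN -mulNr opprB.
by exists u, v; rewrite -Eu -Ev; field; rewrite de0 two_neq0.
Qed.

Lemma quadratic_data : #|G| = 2%N ->
  exists (de : L) (a : K), [/\ de != 0, de ^+ 2 = in_alg L a &
    forall y, exists u v : K, y = in_alg L u + in_alg L v * de].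
Proof.
move=> cG; have [||de [a [de0 Ea _ gen]]] := @quadratic_resolvent 1%G.
- exact: sub1G.
- by rewrite indexg1.
exists de, a; split=> // y; apply: gen; apply/fixedFieldP => [|h]; first exact: memvf.
by rewrite inE => /eqP ->; rewrite gal_id.
Qed.

(** The subgroup generated by an element of order 3 has index 1 or 2 in G. In
    the first case its fixed field is K, with de = 1. *)
Lemma cubic_data : #|G| = 3%N \/ #|G| = 6%N ->
  exists (s : {rmorphism L -> L}) (de : L) (a : K), [/\ de != 0, de ^+ 2 = in_alg L a,
    (forall x, s (s (s x)) = x) /\ (exists x, s x != x) &
    forall y, s y = y -> exists u v : K, y = in_alg L u + in_alg L v * de].
Proof.
move=> cG; have [||s Gs os] := @Cauchy _ 3 G; first by [].
  by case: cG => ->.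
have sHG : <[s]>%g \subset G by rewrite cycle_subG.
have s3 x : s (s (s x)) = x.
  transitivity ((s ^+ 3)%g x); last by rewrite -os expg_order gal_id.
  by rewrite !expgS expg0 mulg1 !galM ?memvf.
have [x sx] : exists x, s x != x.
  apply: contrapT => none; have : s == 1%g.
    apply/gal_eqP => x _; rewrite gal_id; apply/eqP; apply: contrapT => /negP sx.
    by apply: none; exists x.
  by move=> /eqP s1; rewrite s1 order1 in os.
have fixs y : s y = y -> y \in fixedField <[s]>%g.
  move=> sy; apply/fixedFieldP => [|h /cycleP [i ->]]; first exact: memvf.
  elim: i => [|i IH]; first by rewrite expg0 gal_id.
  by rewrite expgSr galM ?memvf // IH.
have [de [a [de0 Ea gen]]] : exists (de : L) (a : K), [/\ de != 0, de ^+ 2 = in_alg L a &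
    forall y, y \in fixedField <[s]>%g -> exists u v : K, y = in_alg L u + in_alg L v * de].
  case: cG => cG.
    exists 1, 1; split; rewrite ?oner_eq0 ?expr1n ?rmorph1 // => y Hy.
    have EG : <[s]>%g = G by apply/eqP; rewrite eqEcard sHG cG -os /= -orderE.
    have [|u Eu] := @fixed_in_base y.
      by move=> g Gg; have [_] := mem_fixedFieldP Hy; apply; rewrite EG.
    by exists u, 0; rewrite rmorph0 mul0r addr0.
  have [||de [a [de0 Ea _ gen]]] := @quadratic_resolvent <[s]>%G.
  - exact: sHG.
  - by rewrite -divgS //= cG -orderE os.
  by exists de, a.
exists s, de, a; split=> //; first by split=> //; exists x.
by move=> y /fixs /gen.
Qed.
End GaloisData.
Local Open Scope classical_set_scope.
Local Open Scope ring_scope.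

(** * Lagrange resolvents *)

Lemma omega_cube (R : comNzRingType) (om : R) : om ^+ 2 = - om - 1 -> om ^+ 3 = 1.
Proof. by move=> E; rewrite exprS E mulrBr mulrN -expr2 E; ring. Qed.

Lemma omega_pow4 (R : comNzRingType) (om : R) : om ^+ 2 = - om - 1 -> (om ^+ 2) ^+ 2 = om.
Proof. by move=> E; rewrite -exprM exprS (omega_cube E) mulr1. Qed.

Lemma omega_mul (R : comNzRingType) (om a0 a1 a2 b0 b1 b2 : R) : om ^+ 2 = - om - 1 ->
  (a0 + om * a1 + om ^+ 2 * a2) * (b0 + om * b1 + om ^+ 2 * b2) =
  (a0 * b0 + a1 * b2 + a2 * b1 - (a0 * b2 + a1 * b1 + a2 * b0)) +
  om * (a0 * b1 + a1 * b0 + a2 * b2 - (a0 * b2 + a1 * b1 + a2 * b0)).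
Proof.
move=> E; transitivity ((a0 * b0 + om ^+ 3 * (a1 * b2 + a2 * b1)) +
    om * (a0 * b1 + a1 * b0 + om ^+ 3 * (a2 * b2)) +
    om ^+ 2 * (a0 * b2 + a1 * b1 + a2 * b0)); first by ring.
by rewrite (omega_cube E) E; ring.
Qed.

Section Lagrange.
Variables (L Om : fieldType) (f : {rmorphism L -> Om}) (s : {rmorphism L -> L}).
Hypothesis s3 : forall x, s (s (s x)) = x.
Hypothesis three_neq0 : (3 : Om) != 0.

Definition resolvent (om : Om) (w : L) : Om := f w + om * f (s w) + om ^+ 2 * f (s (s w)).
(** The extension by om of the fixed field of s. It is given by a formula
    because om may or may not belong to L. *)
Definition fixed_span (om : Om) : set Om :=
  [set y | exists A B : L, [/\ s A = A, s B = B & y = f A + om * f B]].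

(** In the expansion c0 + om c1 + om^2 c2 of the product by om^3 = 1, each c_i
    is fixed by s, because s permutes the conjugates of x and w cyclically.
    For w = x the product is the cube of the resolvent. *)
Lemma resolvent_sq (om : Om) (x w : L) : om ^+ 2 = - om - 1 ->
  fixed_span om (resolvent om w * resolvent om x ^+ 2).
Proof.
move=> Eom; pose y := s x; pose z := s y; pose w1 := s w; pose w2 := s w1.
pose P := x ^+ 2 + y * z *+ 2; pose Q := z ^+ 2 + x * y *+ 2; pose R := y ^+ 2 + x * z *+ 2.
have sP : s P = R by rewrite /P /R rmorphD rmorphXn rmorphMn rmorphM /= s3 -/y; ring.
have sQ : s Q = P by rewrite /P /Q rmorphD rmorphXn rmorphMn rmorphM /= s3 -/y -/z; ring.
have sR : s R = Q by rewrite /Q /R rmorphD rmorphXn rmorphMn rmorphM /= s3 -/y -/z; ring.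
(* P + om Q + om^2 R is the square of the resolvent of x *)
pose c0 := w * P + w1 * R + w2 * Q.
pose c1 := w * Q + w1 * P + w2 * R.
pose c2 := w * R + w1 * Q + w2 * P.
have sc0 : s c0 = c0 by rewrite /c0 !rmorphD !rmorphM /= sP sQ sR s3 -/w1 -/w2; ring.
have sc1 : s c1 = c1 by rewrite /c1 !rmorphD !rmorphM /= sP sQ sR s3 -/w1 -/w2; ring.
have sc2 : s c2 = c2 by rewrite /c2 !rmorphD !rmorphM /= sP sQ sR s3 -/w1 -/w2; ring.
exists (c0 - c2), (c1 - c2); split; rewrite ?rmorphB /= ?sc0 ?sc1 ?sc2 //.
rewrite /resolvent -/y -/z -/w1 -/w2 /c0 /c1 /c2 /P /Q /R.
rewrite [(_ + _) ^+ 2]expr2 (omega_mul _ _ _ _ _ _ Eom).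
set u := (X in _ * (X + om * _)); set v := (X in _ * (u + om * X)).
have -> : u + om * v = u + om * v + om ^+ 2 * 0 by rewrite mulr0 addr0.
rewrite (omega_mul _ _ _ _ _ _ Eom) {}/u {}/v !(rmorphB, rmorphD, rmorphM, rmorphMn, rmorphXn) /=.
by move: (f w) (f w1) (f w2) (f x) (f y) (f z) => a0 a1 a2 b0 b1 b2; congr (_ + om * _); ring.
Qed.

Lemma resolvent_conj (om : Om) (x w : L) : om ^+ 2 = - om - 1 ->
  fixed_span om (resolvent (om ^+ 2) w * resolvent om x).
Proof.
move=> Eom; pose y := s x; pose z := s y; pose w1 := s w; pose w2 := s w1.
(* the coefficients of 1, om and om^2 in the product *)
pose c0 := w * x + w1 * y + w2 * z.
pose c1 := w * y + w1 * z + w2 * x.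
pose c2 := w * z + w1 * x + w2 * y.
have sc0 : s c0 = c0 by rewrite /c0 !rmorphD !rmorphM /= !s3 -/w1 -/w2 -/y -/z; ring.
have sc1 : s c1 = c1 by rewrite /c1 !rmorphD !rmorphM /= !s3 -/w1 -/w2 -/y -/z; ring.
have sc2 : s c2 = c2 by rewrite /c2 !rmorphD !rmorphM /= !s3 -/w1 -/w2 -/y -/z; ring.
exists (c0 - c2), (c1 - c2); split; rewrite ?rmorphB /= ?sc0 ?sc1 ?sc2 //.
rewrite /resolvent -/y -/z -/w1 -/w2 /c0 /c1 /c2 (omega_pow4 Eom) [f w + _ + _]addrAC.
rewrite (omega_mul _ _ _ _ _ _ Eom) !(rmorphB, rmorphD, rmorphM) /=.
by move: (f w) (f w1) (f w2) (f x) (f y) (f z) => a0 a1 a2 b0 b1 b2; congr (_ + om * _); ring.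
Qed.

Lemma resolvent_sum (om : Om) (w : L) : om ^+ 2 = - om - 1 ->
  3 * f w = f (w + s w + s (s w)) + resolvent om w + resolvent (om ^+ 2) w.
Proof.
move=> Eom; rewrite /resolvent !rmorphD /=.
by rewrite (omega_pow4 Eom) Eom; ring.
Qed.

(** If both resolvents of w vanished, 3 w would be the sum of the conjugates of
    w, which is fixed by s. *)
Lemma resolvent_neq0 (om : Om) (w : L) : om ^+ 2 = - om - 1 -> s w != w ->
  exists om', [/\ om' = om \/ om' = om ^+ 2, om' ^+ 2 = - om' - 1 & resolvent om' w != 0].
Proof.
move=> Eom sw.
have [r1|r1] := eqVneq (resolvent om w) 0; last by exists om; split=> //; left.
have [r2|r2] := eqVneq (resolvent (om ^+ 2) w) 0; last first.
  exists (om ^+ 2); split=> //; first by right.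
  by rewrite (omega_pow4 Eom) Eom; ring.
have := resolvent_sum w Eom; rewrite r1 r2 !addr0 => E; case/eqP: sw.
have E' : 3 * w = w + s w + s (s w).
  by apply: (fmorph_inj f); rewrite rmorphM rmorph_nat.
have three : (3 : L) != 0 by rewrite -(fmorph_eq0 f) rmorph_nat.
apply: (mulfI three); have := congr1 s E'; rewrite rmorphM rmorph_nat => ->.
by rewrite E' !rmorphD /= s3; ring.
Qed.
End Lagrange.

(** * Finiteness of the extensions *)

Section Final.
Variables (K : fieldExtType rat) (Om : closedFieldType) (iota : {rmorphism K -> Om}).
Hypothesis alg_iota : forall x : Om, algebraicOver iota x.
Variables (S : set (set K)).
Hypotheses (S_finite : finite_set S) (S_primes : forall p : set K, S p -> is_prime p).

Let j : {rmorphism rat -> Om} := (iota \o in_alg K : {rmorphism rat -> Om}).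

Lemma alg_rat x : algebraicOver j x.
Proof.
apply/integral_algebraic; have [p p0 rp] := alg_iota x.
apply: (@integral_root _ _ j (map_poly iota p) x) => //; first by rewrite map_poly_eq0.
apply/integral_poly => i; rewrite coef_map /=; apply/integral_algebraic.
have [q q0 rq] := algebraic_rat p`_i.
exists (map_poly intr q).
  by rewrite -size_poly_eq0 size_map_inj_poly ?size_poly_eq0 //; exact: intr_inj.
rewrite -(fmorph_root iota) -!map_poly_comp in rq *.
by congr (root _ _): rq; apply: eq_map_poly => n /=; rewrite -in_algE !rmorph_int.
Qed.

Lemma natr_neq0 (F : fieldType) (g : {rmorphism K -> F}) n : (0 < n)%N -> (n%:R : F) != 0.
Proof.
by move=> n0; rewrite -(rmorph_nat g) fmorph_eq0 ((pcharf0P K).1 (@pcharF0 K)) -lt0n.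
Qed.

(** Together with the rational numbers, which lie in every subfield of Om,
    these generate the image of K. *)
Definition base_gens : seq Om := [seq iota v | v <- vbasis {:K}].

Lemma base_gens_sub (F : fieldType) (g : {rmorphism F -> Om}) :
  (forall x, x \in base_gens -> exists y, g y = x) -> forall x : K, exists y, g y = iota x.
Proof.
move=> hg x.
have hg' (i : 'I_(\dim {:K})) : exists y, g y = iota (vbasis {:K})`_i.
  by apply: hg; apply: map_f; rewrite mem_nth // size_tuple.
have [y Ey] := choice hg'.
exists (\sum_i ratr (coord (vbasis {:K}) i x) * y i).
rewrite rmorph_sum {2}(coord_vbasis (memvf x)) rmorph_sum; apply: eq_bigr => i _.
by rewrite rmorphM /= Ey fmorph_rat rmorphZ_num.
Qed.

Section OneExtension.
Variable L : fieldExtType K.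
Hypothesis unr : unramified_outside L S.
Local Notation Lq := (baseFieldType L : fieldExtType rat).
Let c : {rmorphism K -> Lq} := base_embedding L.

(** A uniformizer at a prime P of L above p is found in K, so P has ramification
    index 1, and the valuation of a at p is that of de^2 at P. *)
Lemma quadratic_valuation (de : Lq) (a : K) p : de != 0 -> de ^+ 2 = c a ->
  is_prime p -> ~ S p -> (2 %| pval p a)%Z.
Proof.
move=> de0 Ea hp nSp; have [P hP EP] := lying_over c hp.
have nSP : ~ S (base_embedding L @^-1` P) by rewrite -/c EP.
have [pi pi0 vpi] := unramified_uniformizer unr hP nSP.
have [e e0 He] := pval_morph c hP; rewrite EP in He.
have a0 : a != 0 by rewrite -(fmorph_eq0 c) -Ea expf_neq0.
have e1 : e = 1.
  have E := He pi pi0; rewrite vpi in E.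
  have : (e %| 1%R)%Z by rewrite E dvdz_mulr.
  by rewrite dvdz1 => /eqP; lia.
have := He a a0; rewrite -Ea (pvalX hP) // e1 mul1r => <-.
by rewrite dvdz_mulr.
Qed.
End OneExtension.

(** A square root de of an element of K can be scaled by K, after which its
    square is one of finitely many representatives modulo squares. *)
Lemma quadratic_generators : exists2 De : set Om, finite_set De &
  forall (L : fieldExtType K) (f : {rmorphism L -> Om}) (de : L) (a : K),
    (forall x : K, f (in_alg L x) = iota x) -> unramified_outside L S ->
    de != 0 -> de ^+ 2 = in_alg L a ->
    exists2 b : K, b != 0 & De (iota b * f de).
Proof.
have [A HA] := @selmer_finite K 2 S isT S_finite.
exists [set x | x ^+ 2 \in map iota A]; first exact: finite_nth_roots.
move=> L f de a fK unr de0 Ea.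
have a0 : a != 0.
  have : in_alg L a != 0 by rewrite -Ea expf_neq0.
  by rewrite fmorph_eq0.
have [|b b0 Ab] := HA a a0.
  by move=> p hp nSp; apply: (@quadratic_valuation L unr de a p).
exists b => //=; rewrite exprMn -rmorphXn -[f de ^+ 2]rmorphXn /= Ea fK -rmorphM mulrC.
exact: map_f.
Qed.

Lemma finite_quadratic : finite_set [set E : set Om |
    exists (L : splittingFieldType K) (f : {rmorphism L -> Om}),
      [/\ forall x : K, f (in_alg L x) = iota x, E = range f,
          galois 1%VS {:L}%VS, unramified_outside L S & #|'Gal({:L} / 1)%g| = 2%N]].
Proof.
have [De fDe HDe] := quadratic_generators.
pose Phi (s : Om) : set Om := [set x | exists u v : K, x = iota u + iota v * s].
apply: (@sub_finite_set _ _ (Phi @` De)); last exact: finite_image.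
move=> E /= [L [f [fK -> galL unr cG]]].
have two0 : (2 : L) != 0 by exact: (natr_neq0 (in_alg L)).
have [de [a [de0 Ea gen]]] := quadratic_data galL two0 cG.
have [b b0 Db] := HDe L f de a fK unr de0 Ea.
have ib0 : iota b != 0 by rewrite fmorph_eq0.
exists (iota b * f de) => //; apply/seteqP; split=> x.
  move=> [u [v ->]]; exists (in_alg L u + in_alg L (v * b) * de) => //.
  by rewrite rmorphD rmorphM !fK rmorphM mulrA.
move=> [y _ <-]; have [u [v ->]] := gen y.
exists u, (v / b); rewrite rmorphD rmorphM /= !fK fmorph_div; by field.
Qed.

(** Here s is the scaled generator of the fixed field of sg, and M = K(s, zeta).
    A nonzero Lagrange resolvent al of L has its cube in M. Scaled by M, it is
    one of the finitely many elements of Ga, and L embeds in M(al), which has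
    finitely many subfields. *)
Lemma finite_cubic (s : Om) : finite_set [set E : set Om |
    exists (L : splittingFieldType K) (f : {rmorphism L -> Om})
      (sg : {rmorphism L -> L}) (de : L) (b : K),
      [/\ forall x : K, f (in_alg L x) = iota x, E = range f, unramified_outside L S,
         [/\ forall x, sg (sg (sg x)) = x, exists x, sg x != x &
          forall y, sg y = y -> exists u v : K, y = in_alg L u + in_alg L v * de]
        & b != 0 /\ iota b * f de = s]].
Proof.
have [ze Eze] : exists ze : Om, ze ^+ 2 = - ze - 1.
  have [ze E] := @solve_monicpoly Om 2 (fun i => -1) isT.
  by exists ze; rewrite E !big_ord_recl big_ord0 expr0 expr1; ring.
pose gensM := [:: ze, s & base_gens].
have [M [gM [gM_gens _ gM_univ]]] := @generated_number_field Om j gensM (fun x _ => alg_rat x).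
have [zM EzM] : exists y, gM y = ze by apply: gM_gens; rewrite inE eqxx.
have [sM EsM] : exists y, gM y = s by apply: gM_gens; rewrite !inE eqxx orbT.
have iM : forall x : K, exists y, gM y = iota x.
  by apply: base_gens_sub => x xs; apply: gM_gens; rewrite !inE xs !orbT.
have [cM EcM] := range_sub_morphism iM.
pose T : set (set M) := [set p | is_prime p /\ S (cM @^-1` p)].
have fT : finite_set T.
  have ex (p : set K) : exists x, S p -> p x /\ x != 0.
    have [Sp|nSp] := pselect (S p); last by exists 0.
    by have [x px x0] := prime_nonzero (S_primes Sp); exists x.
  have [a Ha] := choice ex.
  apply: (@sub_finite_set _ _ (\bigcup_(p in S) [set P | is_prime P /\ P (cM (a p))])).
    move=> P [hP SP]; exists (cM @^-1` P) => //; split=> //.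
    by have [] := Ha _ SP.
  apply: bigcup_finite => // p Sp; have [pa a0] := Ha p Sp.
  apply: finite_primes_above; last by rewrite fmorph_eq0.
  by apply: (O_morph cM _).1; exact: (prime_sub (S_primes Sp) pa).
have [A HA] := @selmer_finite M 3 T isT fT.
pose Ga := [set x : Om | x ^+ 3 \in map gM A].
have fGa : finite_set Ga by exact: finite_nth_roots.
pose gensN al := al :: gensM.
pose inN al (E : set Om) := forall (F : fieldType) (g : {rmorphism F -> Om}),
  (forall x, x \in gensN al -> exists y, g y = x) -> forall x, E x -> exists y, g y = x.
apply: (@sub_finite_set _ _ (\bigcup_(al in Ga) [set E | inN al E /\
   exists (L : fieldType) (k : {rmorphism rat -> L}) (f : {rmorphism L -> Om}),
     E = range f])); last first.
  apply: bigcup_finite => // al _.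
  have [N [gN [gN_gens [z [az Hz]] _]]] :=
    @generated_number_field Om j (gensN al) (fun x _ => alg_rat x).
  apply: sub_finite_set (finite_subfields az) => E [HE [L [k [f EE]]]].
  exists L, k, f; split=> // y.
  have [|w <-] := HE N gN gN_gens (f y); first by rewrite EE; exists y.
  exact: Hz.
move=> E [L [f [sg [de [b [fK EE unr [sg3 [x0 sx0] fix_sg] [b0 Es]]]]]]].
pose Lq : fieldExtType rat := baseFieldType L.
pose fq : {rmorphism Lq -> Om} := (f : {rmorphism L -> Om}).
(* gE embeds the compositum of L and K(zeta), which contains M *)
pose gensE := ze :: [seq fq v | v <- vbasis {:Lq}].
have [E' [gE [gE_gens _ gE_univ]]] := @generated_number_field Om j gensE (fun x _ => alg_rat x).
have [zE EzE] : exists y, gE y = ze by apply: gE_gens; rewrite inE eqxx.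
have LE : forall y : Lq, exists y', gE y' = fq y.
  move=> y; have LE' (i : 'I_(\dim {:Lq})) : exists y', gE y' = fq (vbasis {:Lq})`_i.
    by apply: gE_gens; rewrite inE map_f ?orbT // mem_nth // size_tuple.
  have [y' Ey'] := choice LE'.
  exists (\sum_i ratr (coord (vbasis {:Lq}) i y) * y' i).
  rewrite rmorph_sum {2}(coord_vbasis (memvf y)) rmorph_sum; apply: eq_bigr => i _.
  by rewrite rmorphM /= Ey' fmorph_rat rmorphZ_num.
have [cL EcL] := range_sub_morphism LE.
have EzE2 : zE ^+ 2 = - zE - 1.
  by apply: (fmorph_inj gE); rewrite rmorphXn /= EzE Eze rmorphB rmorphN rmorph1 /= EzE.
(* the compositum has degree at most 2 over L *)
have genE : forall y : E', exists u v, y = cL u + cL v * zE.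
  move=> y; pose p : {poly L} := 'X^2 + 'X + 1.
  have sp : size p = 3%N.
    by rewrite /p -addrA size_polyDl ?size_polyXn // -[1]/(1%:P) size_XaddC.
  have p0 : p != 0 by rewrite -size_poly_eq0 sp.
  have rp : root (map_poly f p) ze.
    rewrite /root /p !rmorphD rmorph1 /= map_polyXn map_polyX !hornerE Eze.
    by apply/eqP; ring.
  pose F2 := subFExtend f ze p; pose g2 : {rmorphism F2 -> Om} := @subfx_inj _ _ f ze p.
  have [|y2 Ey2] := gE_univ F2 g2 _ y.
    move=> x; rewrite inE => /predU1P [->|/mapP [v _ ->]].
      by exists (subfx_root f ze p); exact: subfx_inj_root.
    exists (subfx_eval f ze p v%:P).
    by rewrite /g2 /= subfx_inj_eval // map_polyC hornerC.
  have [q Eq] := subfxE y2.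
  have Er : gE y = fq (q %% p)`_0 + fq (q %% p)`_1 * ze.
    rewrite -Ey2 Eq /g2 /= subfx_inj_eval // {1}(divp_eq q p) rmorphD rmorphM /=.
    rewrite hornerD hornerM (rootP rp) mulr0 add0r.
    rewrite (@horner_coef_wide _ 2) ?size_map_poly; last by rewrite -ltnS -sp ltn_modp.
    by rewrite !big_ord_recl big_ord0 expr0 mulr1 addr0 expr1 !coef_map.
  exists (q %% p)`_0, (q %% p)`_1; apply: (fmorph_inj gE).
  by rewrite Er rmorphD rmorphM /= !EcL EzE.
have sE : exists y, gE y = s.
  by exists (cL (in_alg L b * de)); rewrite EcL -Es /fq /= rmorphM fK.
have ME : forall y, exists y', gE y' = gM y.
  apply: gM_univ => x; rewrite !inE => /predU1P [->|/predU1P [->|/mapP [v _ ->]]] //.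
    by exists zE.
  by exists (cL (in_alg L v)); rewrite EcL /fq /= fK.
have [h Eh] := range_sub_morphism ME.
have three0 : (3 : Om) != 0 by exact: (natr_neq0 iota).
have [om [om_ze Eom al0]] := resolvent_neq0 f sg3 three0 Eze sx0.
set al := resolvent f sg om x0 in al0.
have omM : exists y, gM y = om.
  case: om_ze => ->; first by exists zM.
  by exists (zM ^+ 2); rewrite rmorphXn /= EzM.
(* the fixed field of sg is K(s), so that adding om to it leads into M *)
have span_M y : fixed_span f sg om y -> exists m, gM m = y.
  have fixM B : sg B = B -> exists m, gM m = f B.
    move=> /fix_sg [u [v ->]]; exists (cM u + cM (v / b) * sM).
    rewrite rmorphD !rmorphM /= !EcM EsM -Es rmorphD rmorphM /= !fK fmorphV.
    by field; rewrite fmorph_eq0.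
  move=> [B [C [/fixM [m1 E1] /fixM [m2 E2] ->]]]; have [m3 E3] := omM.
  by exists (m1 + m3 * m2); rewrite rmorphD rmorphM /= E1 E2 E3.
have [m Em] := span_M _ (resolvent_sq f sg3 x0 x0 Eom).
rewrite -/al -exprS in Em.
have m0 : m != 0 by rewrite -(fmorph_eq0 gM) Em expf_neq0.
have [a1 Ea1] : exists y, gE y = al.
  have [o Eo] : exists y, gE y = om by have [y <-] := omM; exact: ME.
  exists (cL x0 + o * cL (sg x0) + o ^+ 2 * cL (sg (sg x0))).
  by rewrite !rmorphD !rmorphM /= !EcL Eo /al /resolvent expr2.
have a10 : a1 != 0 by rewrite -(fmorph_eq0 gE) Ea1.
have hm : h m = a1 ^+ 3 by apply: (fmorph_inj gE); rewrite Eh Em rmorphXn /= Ea1.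
have [|b' b'0 Ab'] := HA m m0.
  move=> p hp nTp; have [P hP EP] := lying_over h hp.
  have nSP : ~ S (base_embedding L @^-1` (cL @^-1` P)).
    move=> SP; apply: nTp; split=> //; congr S: SP; rewrite -EP; apply/funext => x.
    congr P; apply: (fmorph_inj gE); rewrite EcL Eh EcM; exact: fK.
  have hPL := prime_preimage cL hP.
  have [pi pi0 vpi] := unramified_uniformizer unr hPL nSP.
  have [e1 [e1_gt0 e1_le2 He1]] := ramification_quadratic hP EzE2 genE.
  have [e2 e2_gt0 He2] := pval_morph h hP; rewrite EP in He2.
  have Epi : cL (base_embedding L pi) = h (cM pi).
    apply: (fmorph_inj gE); rewrite EcL Eh EcM; exact: fK.
  have E12 : e1 = e2 * pval p (cM pi).
    have bpi0 : base_embedding L pi != 0 by rewrite fmorph_eq0.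
    have := He1 _ bpi0; rewrite vpi mulr1 => <-.
    by rewrite Epi He2 // fmorph_eq0.
  have E3 : 3 * pval P a1 = e2 * pval p m by rewrite -He2 // hm pvalX.
  (* e2 divides the ramification index e1 over K, which is at most 2 *)
  have e2_le2 : e2 <= 2.
    have v1 : 0 < pval p (cM pi) by rewrite -(pmulr_rgt0 _ e2_gt0) -E12.
    by rewrite (le_trans _ e1_le2) // E12 ler_peMr // ltW.
  have [e21|e22] : e2 = 1 \/ e2 = 2 by lia.
    by apply/dvdzP; exists (pval P a1); move: E3; rewrite e21; lia.
  by apply/dvdzP; exists (pval p m - pval P a1); move: E3; rewrite e22; lia.
have gb0 : gM b' != 0 by rewrite fmorph_eq0.
exists (al * gM b'); first by rewrite /Ga /= exprMn -Em -rmorphXn -rmorphM; exact: map_f.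
split; last first.
  by exists L, (in_alg Lq : {rmorphism rat -> Lq}), f.
move=> F g hF x; rewrite EE => -[w _ <-].
have inF y : exists y', g y' = gM y.
  by apply: gM_univ => z zs; apply: hF; rewrite inE zs orbT.
have [t Et] : exists t, g t = al.
  have [t1 Et1] : exists t1, g t1 = al * gM b' by apply: hF; rewrite inE eqxx.
  have [t2 Et2] := inF b'.
  by exists (t1 / t2); rewrite fmorph_div Et1 Et2 mulfK.
have [m1 Em1] := span_M _ (resolvent_sq f sg3 x0 w Eom).
have [m2 Em2] := span_M _ (resolvent_conj f sg3 x0 w Eom).
have [m3 Em3] : exists m, gM m = f (w + sg w + sg (sg w)).
  apply: span_M; exists (w + sg w + sg (sg w)), 0; rewrite !rmorph0 mulr0 addr0.
  by split=> //; rewrite !rmorphD /= sg3; ring.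
have [y1 Ey1] := inF m1; have [y2 Ey2] := inF m2; have [y3 Ey3] := inF m3.
(* w is one third of the sum of its trace and its two resolvents, expressed by
   al and elements of M *)
exists ((y3 + y1 / t ^+ 2 + y2 / t) / 3).
apply: (mulfI three0); rewrite (resolvent_sum f sg w Eom).
rewrite fmorph_div rmorph_nat !rmorphD !fmorph_div rmorphXn /= Ey1 Ey2 Ey3 Et Em1 Em2 Em3 -/al.
by field; rewrite al0 three0.
Qed.
End Final.

Theorem theorem3p3 (K : fieldExtType rat)
    (Kbar : closedFieldType) (iota : {rmorphism K -> Kbar})
    (Kbar_algebraic : forall x : Kbar, algebraicOver iota x)
    (S : set (set K)) (S_finite : finite_set S)
    (S_primes : forall p : set K, S p -> is_prime p) :
  finite_set [set E : set Kbar |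
    exists (L : splittingFieldType K) (f : {rmorphism L -> Kbar}),
      [/\ forall x : K, f (in_alg L x) = iota x,
          E = range f,
          galois 1%VS {:L}%VS,
          unramified_outside L S
        & gal_C2_C3_or_S3 L]].
Proof.
have [De fDe HDe] := quadratic_generators iota S_finite.
have quad := finite_quadratic iota S_finite.
have cub s := finite_cubic Kbar_algebraic S_finite S_primes s.
have fin := (conj quad (bigcup_finite fDe (fun s _ => cub s))).
rewrite -finite_setU in fin; apply: sub_finite_set fin.
move=> E /= [L [f [fK EE galL unr cG]]].
have card2 : (#|'Gal({:L} / 1)%g| = 2 \/ (#|'Gal({:L} / 1)%g| = 3 \/ #|'Gal({:L} / 1)%g| = 6))%N.
  case: cG => /card_isog ->; [left | right; left | right; right].
  - by rewrite card_Zp.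
  - by rewrite card_Zp.
  - by rewrite cardsT card_Sn.
case: card2 => [c2|c36]; first by left; exists L, f.
have two0 : (2 : L) != 0 by exact: (natr_neq0 (in_alg L)).
have [sg [de [a [de0 Ea [sg3 sg1] fix_sg]]]] := cubic_data galL two0 c36.
right; have [b b0 Db] := HDe L f de a fK unr de0 Ea.
exists (iota b * f de) => //.
by exists L, f, sg, de, b.
Qed.
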